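(* Let $G=(V,E)$ be a $2$-connected graph with $\kappa(G)=2$. Let $M$ be any well-signed $G$-matrix with exactly one negative eigenvalue and with corank $2$. Then the normalized nullspace representation $u:V\to\mathbb{R}^2$ defined by $M$ is an outerplanar embedding of $G$.
   Context: $G=(V,E)$ is a finite simple undirected graph with $V=[n]$. A $G$-matrix is a symmetric real $V\times V$ matrix $M$ with $M_{ij}=0$ whenever $i,j$ are distinct nonadjacent nodes (no condition on diagonal entries). It is well-signed if $M_{ij}<0$ whenever $i,j$ are distinct adjacent nodes. The corank of $M$ is $\dim\ker M$, and eigenvalues are counted with multiplicity. $\kappa(G)$ is the largest $d$ for which there exists a well-signed $G$-matrix with exactly one negative eigenvalue and with corank $d$. Nullspace representation: if $M$ has corank $d$, let $U\in\mathbb{R}^{d\times n}$ be a matrix whose rows form a basis of $\ker M$ and let $u_i\in\mathbb{R}^d$ be the column of $U$ indexed by $i$; the map $i\mapsto u_i$ is the nullspace representation defined by $M$ (unique up to a linear transformation of $\mathbb{R}^d$). When all $u_i\neq 0$, the normalized nullspace representation is obtained by replacing each $u_i$ by $u_i/|u_i|$ (for a $2$-connected graph and $M$ a well-signed $G$-matrix with exactly one negative eigenvalue and corank $\kappa(G)$, all $u_i$ are nonzero, so this is defined). Any choice of basis of $\ker M$ is allowed. A map $u:V\to\mathbb{R}^2$ is extended to the edges by mapping each edge $ij$ to the straight line segment between $u_i$ and $u_j$. The map $u$ is called outerplanar (an outerplanar embedding of $G$) if this extension is an embedding of $G$ in the plane (distinct nodes are mapped to distinct points, and segments of distinct edges meet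 each other, and contain node images, only at common endpoints or own endpoints, respectively) and each $u_i$ is incident with the unbounded face of this embedding. *)

(* Defs.v *)
From mathcomp Require Import all_boot all_order all_algebra.
From mathcomp Require Import all_classical all_reals all_analysis.
Import Order.TTheory GRing.Theory Num.Theory.
Import numFieldNormedType.Exports.

Set Implicit Arguments.
Unset Strict Implicit.
Unset Printing Implicit Defensive.

Local Open Scope classical_set_scope.
Local Open Scope ring_scope.

Record sgraph (n : nat) := SGraph {
  adj :> rel 'I_n;
  adj_sym : symmetric adj;
  adj_irr : irreflexive adj }.

Definition connected_on n (G : sgraph n) (A : {set 'I_n}) : Prop :=
  {in A &, forall x y,
    connect [rel a b | [&& a \in A, b \in A & G a b]] x y}.

(* k-connectivity for k = 2: more than k nodes, and no set of fewer than k
   nodes separates the graph. *)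
Definition two_connected n (G : sgraph n) : Prop :=
  (2 < n)%N /\
  forall S : {set 'I_n}, (#|S| < 2)%N -> connected_on G (~: S)%SET.

Section GMatrices.
Variables (R : realType) (n : nat) (G : sgraph n).
Implicit Type M : 'M[R]_n.

Definition G_matrix M : Prop :=
  M^T = M /\ forall i j, i != j -> ~~ G i j -> M i j = 0.

Definition well_signed M : Prop := forall i j, G i j -> M i j < 0.

(* Rows of this matrix span ker M = {x | M x = 0}: kermx is a left kernel,
   hence the transpose. *)
Definition nullspace M : 'M[R]_n := kermx M^T.

Definition corank M : nat := \rank (nullspace M).

(* s lists the eigenvalues of M with multiplicity. *)
Definition spectrum M (s : seq R) : Prop :=
  char_poly M = \prod_(a <- s) ('X - a%:P).

Definition one_negative_eigenvalue M : Prop :=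
  exists2 s, spectrum M s & count (fun a => a < 0) s = 1%N.

Definition admissible M : Prop :=
  [/\ G_matrix M, well_signed M & one_negative_eigenvalue M].

(* The bound d <= n loses nothing, since a corank never exceeds n. *)
Definition kappa : nat :=
  \max_(d < n.+1 | `[< exists2 M, admissible M & corank M = d >]) d.

End GMatrices.

Definition nullspace_basis (R : realType) n d
    (M : 'M[R]_n) (U : 'M[R]_(d, n)) : Prop :=
  row_free U /\ (U :=: nullspace M)%MS.

(* The library norm on matrices is the sup norm. *)
Definition euclidean_norm (R : realType) d (x : 'cV[R]_d) : R :=
  Num.sqrt (\sum_k x k ord0 ^+ 2).

Definition nullspace_rep (R : realType) n d (U : 'M[R]_(d, n))
  (i : 'I_n) : 'cV[R]_d := col i U.

Definition normalized_nullspace_rep (R : realType) n d (U : 'M[R]_(d, n))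
    (i : 'I_n) : 'cV[R]_d :=
  (euclidean_norm (nullspace_rep U i))^-1 *: nullspace_rep U i.

Section PlaneDrawings.
Variables (R : realType) (n : nat) (G : sgraph n).
Implicit Type u : 'I_n -> 'cV[R]_2.

Definition segment (p q : 'cV[R]_2) : set 'cV[R]_2 :=
  [set x | exists t : R, [/\ 0 <= t, t <= 1 & x = (1 - t) *: p + t *: q]].

Definition drawing u : set 'cV[R]_2 :=
  [set x | (exists i, x = u i) \/
           (exists i j, G i j /\ segment (u i) (u j) x)].

Definition straight_line_embedding u : Prop :=
  [/\ injective u,
      forall i j k, G i j -> segment (u i) (u j) (u k) -> k = i \/ k = j
    & forall i j k l, G i j -> G k l -> [set i; j]%SET != [set k; l]%SET ->
        forall x, segment (u i) (u j) x -> segment (u k) (u l) x ->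
        exists2 v, v \in ([set i; j] :&: [set k; l])%SET & x = u v].

Definition face u (F : set 'cV[R]_2) : Prop :=
  exists2 x, ~ drawing u x & F = connected_component (~` drawing u) x.

(* A node lies on the drawing, so it is on the boundary of a face exactly when
   it is in the closure of that face. *)
Definition on_unbounded_face u (i : 'I_n) : Prop :=
  exists F, [/\ face u F, ~ bounded_set F & closure F (u i)].

Definition outerplanar_embedding u : Prop :=
  straight_line_embedding u /\ forall i, on_unbounded_face u i.

End PlaneDrawings.

(* Main.v *)
Require Import Defs.
From mathcomp Require Import complex perm all_boot all_order all_algebra.
From mathcomp Require Import all_classical all_reals all_analysis.
From mathcomp Require Import ring lra zify.
Import Order.TTheory GRing.Theory Num.Theory.
Import numFieldNormedType.Exports.

Set Implicit Arguments.
Unset Strict Implicit.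
Unset Printing Implicit Defensive.

Local Open Scope ring_scope.

(** A symmetric matrix N whose kernel contains the coordinates of the vectors u_i is the
    same thing as a circulation on the graph: the kernel equation at i says that the
    numbers N i j * det (u_i, u_j) sum to zero, and the diagonal is then determined. For
    the given M all edges between non-parallel nodes, directed counterclockwise, carry a
    flow of the same sign. The proof shows that going from each node to its first
    neighbour counterclockwise visits all nodes in one turn, and that no edge crosses
    another.

    The assumption on kappa enters through two constructions of a matrix of corank 3.
    First, three_neighbours: if any two of three neighbours of v can be linked in the
    graph without v and the third one, then eliminating all other nodes leaves a 4 x 4
    matrix whose off-diagonal entries can be adjusted to those of a negative semidefinite
    matrix of rank one. Second, lorentz_deform: if N vanishes on the kernel of M, has
    nonpositive entries on the edges and zeros elsewhere off the diagonal, and a negative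
    vector of M is not positive for N, then along M + t N a second negative eigenvalue
    could only appear after the corank has jumped.

    The one negative eigenvalue of M gives van der Holst's lemma (pos_part_connected):
    the nodes of an open halfplane induce a connected subgraph. No u_i vanishes, as
    lowering the diagonal entry of M at i shows (kernel_nonvanishing). With
    three_neighbours it follows that every node has neighbours on both sides
    (zero_has_neighbour), and that among neighbours of v on the same side the nearer one
    is separated by v and the farther one from the rest (nearer_neighbour_cut_off).
    Consequently the map s to the first neighbour is injective (first_out_inj), and the
    matrix N of one unit of flow along each arc from v to s v exists. If s left some
    halfplane at two places, N, and hence M + t N for large t, would have two orthogonal
    negative vectors, which lorentz_deform excludes (single_exit). So s makes a single
    turn through all directions, directions are distinct (directions_inj), and edges do
    not leave the sector spanned by another edge (chord_sector). For unit vectors the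
    sector of two nodes consists of what lies beyond
    their chord (side_sector), so that chords do not cross; two diameters are excluded by
    no_two_diameters. Finally a node on the unit circle sees infinity along its ray. *)

(** * Symmetric matrices and their quadratic forms *)

(** Over the complex numbers a real symmetric matrix is hermitian, so the eigenvalues
    of its unitary diagonalization are real, and they are roots of the real
    characteristic polynomial. *)
Lemma sym_eigenvalue (R : rcfType) n (M : 'M[R]_n.+1) :
  M^T = M -> exists a, eigenvalue M a.
Proof.
move=> M_sym; pose f := real_complex R.
have A_herm : map_mx f M \is hermsymmx.
  apply: realsym_hermsym.
    apply/is_hermitianmxP; rewrite expr0 scale1r; apply/matrixP => i j.
    by rewrite !mxE -[in RHS]M_sym mxE.
  by apply/mxOverP => i j; rewrite mxE complex_real.
have /mxOverP/(_ 0 0) := hermitian_spectral_diag_real A_herm.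
set d := spectral_diag _ => /complex_realP[k d00].
have := A_herm => /hermitian_normalmx /orthomx_spectralP.
set P := spectralmx _; rewrite -/d => A_eq.
have P_unit : P \in unitmx by exact: spectral_unit.
exists k; rewrite eigenvalue_root_char -(fmorph_root f).
have -> : map_poly f (char_poly M) = char_poly (map_mx f M).
  by rewrite map_char_poly.
rewrite -eigenvalue_root_char; apply/eigenvalueP; exists (row 0 P).
  rewrite {1}A_eq -row_mul !mulmxA mulmxV // mul1mx.
  by rewrite row_mul row_diag_mx -scalemxAl -rowE d00.
apply: contraL P_unit => /eqP row0; apply/negP => /mulmxV.
move=> /(congr1 (row 0)); rewrite row_mul row0 mul0mx => /rowP/(_ 0).
by rewrite !mxE eqxx => /esym/eqP; rewrite oner_eq0.
Qed.

Lemma sum_sqr_gt0 (R : realDomainType) n (x : 'rV[R]_n) :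
  x != 0 -> 0 < (x *m x^T) 0 0.
Proof.
move=> x_neq0; rewrite mxE lt_def; apply/andP; split; last first.
  by apply: sumr_ge0 => i _; rewrite mxE -expr2 sqr_ge0.
apply: contra x_neq0; rewrite psumr_eq0 => [/allP x0|i _]; last first.
  by rewrite mxE -expr2 sqr_ge0.
apply/eqP/rowP => i; have := x0 i (mem_index_enum _).
by rewrite /= !mxE mulf_eq0 orbb => /eqP.
Qed.

(** The reflection exchanging v with the first coordinate vector, along their
    difference w. *)
Lemma householder (R : rcfType) n (v : 'rV[R]_n.+1) :
  (v *m v^T) 0 0 = 1 -> exists H : 'M[R]_n.+1,
    [/\ H^T = H, H *m H = 1%:M & delta_mx 0 0 *m H = v].
Proof.
move=> v_unit; pose e : 'rV[R]_n.+1 := delta_mx 0 0.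
have [v_e | v_neq] := eqVneq v e.
  by exists 1%:M; rewrite trmx1 mulmx1 mulmx1 v_e.
have [w wE] : exists w, w = v - e by exists (v - e).
have w_neq0 : w != 0 by rewrite wE subr_eq0.
have dot2 : (w *m w^T) 0 0 = 2 * (1 - v 0 0).
  have subE (A B : 'M[R]_1) : (A - B) 0 0 = A 0 0 - B 0 0 by rewrite !mxE.
  have dotr (x : 'rV[R]_n.+1) : (x *m e^T) 0 0 = x 0 0.
    rewrite mxE (bigD1 ord0) //= big1 => [|j j0]; rewrite !mxE ?eqxx ?mulr1 ?addr0 //.
    by rewrite (negPf j0) mulr0.
  have dotl : (e *m v^T) 0 0 = v 0 0.
    by rewrite -[e *m _]trmxK trmx_mul trmxK mxE dotr.
  rewrite wE linearB /= mulmxBl !mulmxBr !subE v_unit !dotr dotl mxE !eqxx /= mulr1n.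
  by ring.
pose s := (w *m w^T) 0 0; have s_gt0 : 0 < s by exact: sum_sqr_gt0.
have wwT : w *m w^T = s%:M by rewrite [LHS]mx11_scalar.
exists (1%:M - (2 / s) *: (w^T *m w)); split.
- by rewrite linearB /= linearZ /= trmx_mul trmxK trmx1.
- rewrite mulmxBl mul1mx mulmxBr mulmx1 -!scalemxAl -!scalemxAr scalerA.
  rewrite !mulmxA -(mulmxA w^T) wwT mul_mx_scalar -scalemxAl scalerA.
  have -> : 2 / s * (2 / s) * s = 2 / s + 2 / s by field; rewrite gt_eqF.
  rewrite scalerDl; set X := _ *: _.
  by rewrite opprB addrK subrK.
rewrite mulmxBr mulmx1 -scalemxAr mulmxA.
have -> : delta_mx 0 0 *m w^T = (w 0 0)%:M :> 'M[R]_1.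
  rewrite [LHS]mx11_scalar; congr (_%:M); rewrite mxE (bigD1 ord0) //= big1.
    by rewrite !mxE eqxx mul1r addr0.
  by move=> j j0; rewrite !mxE (negPf j0) mul0r.
rewrite mul_scalar_mx scalerA.
have -> : 2 / s * w 0 0 = - 1.
  rewrite /s dot2 wE !mxE eqxx /= mulr1n; field.
  by apply: contraTneq s_gt0; rewrite /s dot2 => ->; rewrite mulr0 ltxx.
by rewrite scaleN1r opprK wE addrC subrK.
Qed.

(** The spectral theorem for real symmetric matrices, by deflation: a Householder
    reflection moves a unit eigenvector to the first coordinate vector. *)
Theorem sym_diag (R : rcfType) n (M : 'M[R]_n) : M^T = M ->
  exists (Q : 'M[R]_n) (d : 'rV[R]_n),
    Q *m Q^T = 1%:M /\ M = Q^T *m diag_mx d *m Q.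
Proof.
elim: n M => [|n IHn] M M_sym.
  by exists 1%:M, 0; split; apply/matrixP => [[]].
have [a /eigenvalueP[v' v'M v'_neq0]] := sym_eigenvalue M_sym.
have s_gt0 := sum_sqr_gt0 v'_neq0; set s := (_ *m _) _ _ in s_gt0.
pose v := (Num.sqrt s)^-1 *: v'.
have vM : v *m M = a *: v by rewrite -scalemxAl v'M !scalerA mulrC.
have v_unit : (v *m v^T) 0 0 = 1.
  rewrite /v linearZ /= -scalemxAl -scalemxAr !scalerA mxE -/s -invfM -expr2.
  by rewrite sqr_sqrtr ?(ltW s_gt0) // mulVf // gt_eqF.
have [H [H_sym HH eH]] := householder v_unit.
pose e : 'rV[R]_n.+1 := delta_mx 0 0.
have vH : v *m H = e by rewrite -eH -mulmxA HH mulmx1.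
have [B BE] : exists B : 'M[R]_(1 + n), B = H *m M *m H by exists (H *m M *m H).
have B_sym : B^T = B by rewrite BE !trmx_mul H_sym M_sym mulmxA.
have eB : e *m B = a *: e by rewrite BE !mulmxA eH vM -scalemxAl vH.
have B0 j : B 0 j = a * (j == 0)%:R.
  have /rowP/(_ j) := eB; rewrite -rowE !mxE => ->.
  by rewrite eqxx.
pose B' := drsubmx B.
have B'_sym : B'^T = B' by rewrite /B' trmx_drsub B_sym.
have B_block : B = block_mx a%:M 0 0 B'.
  have lshift0 : lshift n (0 : 'I_1) = 0 by exact: val_inj.
  have ur0 : ursubmx B = 0.
    by apply/matrixP => i j; rewrite !mxE ord1 lshift0 B0 -val_eqE /= mulr0.
  rewrite -[B]submxK -/B' ur0; congr block_mx; last first.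
    by rewrite -B_sym -trmx_ursub ur0 trmx0.
  by apply/matrixP => i j; rewrite !ord1 !mxE lshift0 B0 eqxx mulr1.
have [Q' [d' [QQ' B'E]]] := IHn _ B'_sym.
exists ((block_mx 1%:M 0 0 Q' : 'M[R]_(1 + n)) *m H), (row_mx a%:M d').
set K := block_mx _ _ _ _.
have KT : K^T = block_mx 1%:M 0 0 Q'^T :> 'M[R]_(1 + n).
  by rewrite tr_block_mx trmx1 !trmx0.
rewrite !trmx_mul H_sym; split.
  rewrite mulmxA -(mulmxA K) HH mulmx1 KT.
  have : K *m block_mx 1%:M 0 0 Q'^T = 1%:M :> 'M[R]_(1 + n).
    rewrite mulmx_block !mulmx0 !mul0mx !addr0 !add0r mulmx1 QQ'.
    by rewrite -scalar_mx_block.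
  by [].
have -> : diag_mx (row_mx a%:M d') = block_mx a%:M 0 0 (diag_mx d') :> 'M[R]_(1 + n).
  rewrite diag_mx_row; congr block_mx.
  by apply/matrixP => i j; rewrite !ord1 !mxE eqxx.
rewrite -[LHS]mul1mx -HH -[LHS]mulmx1 -[in LHS]HH.
have -> : H *m H *m M *m (H *m H) = H *m B *m H by rewrite BE !mulmxA.
have -> : B = block_mx 1%:M 0 0 Q'^T *m block_mx a%:M 0 0 (diag_mx d') *m K.
  rewrite B_block !mulmx_block !mulmx0 !mul0mx !addr0 !add0r !mulmx1 !mul1mx.
  by rewrite -B'E mul0mx.
by rewrite KT !mulmxA.
Qed.

Definition bform (R : realType) n (M : 'M[R]_n) (x y : 'rV[R]_n) : R :=
  (x *m M *m y^T) 0 0.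

(** A symmetric form has at most one negative eigenvalue exactly when it satisfies the
    reversed Cauchy-Schwarz inequality on its negative vectors. In this shape the
    condition involves no eigenvalues and passes to limits. *)
Definition lorentz (R : realType) n (M : 'M[R]_n) : Prop :=
  forall x y, bform M x x < 0 ->
    bform M x x * bform M y y <= bform M x y ^+ 2.

Section Forms.
Variables (R : realType) (n : nat).
Implicit Types (M N : 'M[R]_n) (x y z : 'rV[R]_n).

Lemma bformE M x y : bform M x y = \sum_j (x *m M) 0 j * y 0 j.
Proof. by rewrite /bform mxE; apply: eq_bigr => j _; rewrite !mxE. Qed.

Lemma bformDl M x y z : bform M (x + y) z = bform M x z + bform M y z.
Proof. by rewrite /bform !mulmxDl mxE. Qed.

Lemma bformDr M x y z : bform M z (x + y) = bform M z x + bform M z y.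
Proof. by rewrite /bform linearD mulmxDr mxE. Qed.

Lemma bformZl M a x y : bform M (a *: x) y = a * bform M x y.
Proof. by rewrite /bform -!scalemxAl mxE. Qed.

Lemma bformZr M a x y : bform M x (a *: y) = a * bform M x y.
Proof. by rewrite /bform linearZ -scalemxAr mxE. Qed.

Lemma bformNl M x y : bform M (- x) y = - bform M x y.
Proof. by rewrite -scaleN1r bformZl mulN1r. Qed.

Lemma bformNr M x y : bform M x (- y) = - bform M x y.
Proof. by rewrite -scaleN1r bformZr mulN1r. Qed.

Lemma bformDM M N x y : bform (M + N) x y = bform M x y + bform N x y.
Proof. by rewrite /bform mulmxDr mulmxDl mxE. Qed.

Lemma bformZM a M x y : bform (a *: M) x y = a * bform M x y.
Proof. by rewrite /bform -scalemxAr -scalemxAl mxE. Qed.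

Lemma bformNM M x y : bform (- M) x y = - bform M x y.
Proof. by rewrite -scaleN1r bformZM mulN1r. Qed.

Lemma bformC M x y : M^T = M -> bform M x y = bform M y x.
Proof.
by move=> M_sym; rewrite /bform -[in LHS]M_sym -{1}[x]trmxK -!trmx_mul mxE mulmxA.
Qed.

Lemma bform_ker M x y : x *m M = 0 -> bform M x y = 0.
Proof. by move=> xM; rewrite /bform xM mul0mx mxE. Qed.

Lemma bform_deltar M x j : bform M x (delta_mx 0 j) = (x *m M) 0 j.
Proof. by rewrite /bform trmx_delta -colE mxE. Qed.

Lemma bform_eq0 M x : (forall y, bform M x y = 0) -> x *m M = 0.
Proof.
by move=> x0; apply/rowP => j; rewrite -bform_deltar x0 mxE.
Qed.

(** Two vectors on which a linear form takes the values a, b have a common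
    combination on which it vanishes; there the quadratic form is not negative,
    so it is not negative definite on their span. *)
Lemma lorentz_hyperplane M (l : 'rV[R]_n -> R) : M^T = M ->
  (forall a x y, l (a *: x + y) = a * l x + l y) ->
  (forall x, l x = 0 -> 0 <= bform M x x) -> lorentz M.
Proof.
move=> M_sym l_lin M_ge0 x y x_lt0.
have l0 : l 0 = 0 by have := l_lin (- 1) 0 0; rewrite scaler0 addr0 mulN1r addNr.
have lx_neq0 : l x != 0.
  by apply: contraTneq x_lt0 => /M_ge0; rewrite -leNgt.
have : 0 <= bform M (l y *: x + - l x *: y) (l y *: x + - l x *: y).
  apply: M_ge0; rewrite l_lin -[_ *: y]addr0 l_lin l0; ring.
rewrite !(bformDl, bformDr, bformZl, bformZr) (bformC y x) //.
set p := bform M x x in x_lt0 *; set b := bform M x y; set r := bform M y y.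
set s := l y; set t := l x in lx_neq0 * => w_ge0.
rewrite -(ler_pM2l (_ : 0 < t ^+ 2)); last by rewrite exprn_even_gt0.
rewrite -subr_ge0.
have -> : t ^+ 2 * b ^+ 2 - t ^+ 2 * (p * r) =
   (s * p - t * b) ^+ 2 + (- p) * (s * (s * p) + s * (- t * b) +
      (- t * (s * b) + - t * (- t * r))) by ring.
rewrite addr_ge0 ?sqr_ge0 //; apply: mulr_ge0; first by rewrite oppr_ge0 ltW.
by move: w_ge0; congr (_ <= _); ring.
Qed.

(** It is enough to test one negative vector: its orthogonal complement is the
    hyperplane of the preceding lemma. *)
Lemma lorentz_complement M e : M^T = M -> bform M e e < 0 ->
  (forall y, bform M e e * bform M y y <= bform M e y ^+ 2) -> lorentz M.
Proof.
move=> M_sym e_lt0 M_e; apply: (@lorentz_hyperplane _ (bform M e)) => //.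
  by move=> a x y; rewrite bformDr bformZr.
by move=> x ex0; have := M_e x; rewrite ex0 expr0n /= nmulr_rle0.
Qed.

Section PositiveSemidefinite.
Variable M : 'M[R]_n.
Hypothesis M_sym : M^T = M.

(** Along the line x + t y the form is 2 t b + t^2 r, which takes a negative value for
    a small t of sign opposite to b unless b = 0. Only this line needs to be free of
    negative vectors, so that the lemma applies inside a hyperplane. *)
Lemma isotropic_orth x y : bform M x x = 0 ->
  (forall t, 0 <= bform M (x + t *: y) (x + t *: y)) -> bform M x y = 0.
Proof.
move=> x0 M_ge0; apply/eqP; rewrite -sqrf_eq0; apply/eqP.
set b := bform M x y; set r := bform M y y.
have M_t t : 0 <= 2 * t * b + t ^+ 2 * r.
  have := M_ge0 t; rewrite !(bformDl, bformDr, bformZl, bformZr) (bformC y x) // x0.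
  by rewrite -/b -/r; congr (_ <= _); ring.
apply: le_anti; rewrite sqr_ge0 andbT.
(* A step of size b / (1 + |r|) keeps the quadratic term below the linear one. *)
have := M_t (- b / (1 + `|r|)).
have r1 : 0 < 1 + `|r| by rewrite ltr_pwDl.
have -> : 2 * (- b / (1 + `|r|)) * b + (- b / (1 + `|r|)) ^+ 2 * r =
   b ^+ 2 * (r - 2 - 2 * `|r|) / (1 + `|r|) ^+ 2 by field; rewrite gt_eqF.
rewrite pmulr_lge0; last by rewrite invr_gt0 exprn_gt0.
have r_lt : r - 2 - 2 * `|r| < 0 by have := ler_norm r; have := normr_ge0 r; lra.
by rewrite nmulr_lge0.
Qed.

Lemma psd_isotropic x : (forall y, 0 <= bform M y y) -> bform M x x = 0 ->
  x *m M = 0.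
Proof. by move=> M_ge0 x0; apply: bform_eq0 => y; apply: isotropic_orth. Qed.

(** The orthogonal complement of a negative vector e is positive semidefinite, and
    together with e it spans everything. *)
Lemma lorentz_isotropic e x : lorentz M -> bform M e e < 0 ->
  bform M e x = 0 -> bform M x x <= 0 -> x *m M = 0.
Proof.
move=> M_lor e_lt0 ex0 x_le0.
have M_ge0 y : bform M e y = 0 -> 0 <= bform M y y.
  by move=> ey0; have := M_lor e y e_lt0; rewrite ey0 expr0n /= nmulr_rle0.
have x0 : bform M x x = 0 by apply: le_anti; rewrite x_le0 M_ge0.
apply: bform_eq0 => y; pose c := bform M e y / bform M e e.
have ce : bform M e (y - c *: e) = 0.
  by rewrite bformDr bformNr bformZr /c divfK ?subrr // lt_eqF.
have -> : y = (y - c *: e) + c *: e by rewrite subrK.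
rewrite bformDr bformZr (bformC x e) // ex0 mulr0 addr0.
apply: isotropic_orth => // t; apply: M_ge0.
by rewrite bformDr bformZr ce ex0 mulr0 addr0.
Qed.

End PositiveSemidefinite.
End Forms.

Lemma card_count (T : finType) (p : pred T) :
  #|[pred x | p x]| = count p (index_enum T).
Proof. by rewrite -sum1_card -sum1_count; apply: eq_bigl. Qed.

Section Inertia.
Variables (R : realType) (n : nat).
Implicit Types (M N Q : 'M[R]_n) (d x y : 'rV[R]_n).

Lemma bform_diag Q d x y : bform (Q^T *m diag_mx d *m Q) x y =
  \sum_i d 0 i * (x *m Q^T) 0 i * (y *m Q^T) 0 i.
Proof.
have -> : bform (Q^T *m diag_mx d *m Q) x y =
    bform (diag_mx d) (x *m Q^T) (y *m Q^T).
  by rewrite /bform trmx_mul trmxK !mulmxA.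
rewrite bformE; apply: eq_bigr => i _; rewrite mul_mx_diag mxE.
by rewrite [_ * d _ _]mulrC.
Qed.

Lemma char_poly_sym_diag Q d : Q *m Q^T = 1%:M ->
  char_poly (Q^T *m diag_mx d *m Q) = \prod_i ('X - (d 0 i)%:P).
Proof.
move=> QQ; have QQ' : Q^T *m Q = 1%:M by apply: mulmx1C.
have -> : \prod_i ('X - (d 0 i)%:P) = char_poly (diag_mx d).
  rewrite char_poly_trig ?diag_mx_is_trig //.
  by apply: eq_bigr => i _; rewrite mxE eqxx mulr1n.
rewrite /char_poly /char_poly_mx !map_mxM.
set Qp := map_mx polyC Q; set Qpt := map_mx polyC Q^T.
have QpQ : Qpt *m Qp = 1%:M by rewrite -map_mxM QQ' map_mx1.
have -> : 'X%:M - Qpt *m map_mx polyC (diag_mx d) *m Qp =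
    Qpt *m ('X%:M - map_mx polyC (diag_mx d)) *m Qp.
  rewrite mulmxBr mulmxBl mul_mx_scalar -scalemxAl QpQ.
  by rewrite scalemx1.
rewrite !det_mulmx mulrAC -det_mulmx QpQ det1 mul1r //.
Qed.

Lemma lorentz_of_one_negative M :
  M^T = M -> one_negative_eigenvalue M -> lorentz M.
Proof.
move=> M_sym; have [Q [d [QQ ME]]] := sym_diag M_sym.
case=> s; rewrite /spectrum ME char_poly_sym_diag //.
rewrite -(big_map (fun i => d 0 i) xpredT (fun a => 'X - a%:P)) /=.
move=> /prod_XsubC_eq /permP <-; rewrite count_map => count1.
have /card1P[i0 i0P] : #|[pred i | d 0 i < 0]| == 1%N.
  by rewrite (card_count (fun i => d 0 i < 0)); apply/eqP.
apply: (@lorentz_hyperplane _ _ _ (fun x => (x *m Q^T) 0 i0)).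
- by rewrite -ME.
- by move=> a x y; rewrite mulmxDl -scalemxAl !mxE.
move=> x x0; rewrite bform_diag; apply: sumr_ge0 => i _.
have [->|i_neq] := eqVneq i i0; first by rewrite x0 mulr0.
rewrite -mulrA mulr_ge0 -?expr2 ?sqr_ge0 // leNgt.
by have := i0P i; rewrite !inE (negPf i_neq) => ->.
Qed.

Lemma one_negative_of_lorentz M e : M^T = M -> lorentz M ->
  bform M e e < 0 -> one_negative_eigenvalue M.
Proof.
move=> M_sym M_lor e_lt0; have [Q [d [QQ ME]]] := sym_diag M_sym.
have QQ' : Q^T *m Q = 1%:M by apply: mulmx1C.
exists [seq d 0 i | i <- index_enum 'I_n].
  by rewrite /spectrum ME char_poly_sym_diag // big_map.
rewrite count_map; set N := [pred i | d 0 i < 0].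
have -> : count (preim (fun i => d 0 i) (fun a => a < 0)) (index_enum 'I_n) =
    #|N| by rewrite card_count.
apply/eqP; rewrite eqn_leq; apply/andP; split; last first.
  rewrite lt0n; apply: contraTneq e_lt0 => /card0_eq N0; rewrite -leNgt.
  rewrite ME bform_diag; apply: sumr_ge0 => i _.
  by rewrite -mulrA mulr_ge0 -?expr2 ?sqr_ge0 // leNgt; have := N0 i; rewrite !inE => ->.
rewrite leqNgt; apply/negP => /card_gt1P[i [j [iN jN ij]]].
have fE k l : bform M (row k Q) (row l Q) = d 0 k * (k == l)%:R.
  rewrite ME bform_diag -!row_mul QQ (bigD1 k) //= big1 => [|m mk]; rewrite !mxE.
    by rewrite eqxx mulr1 addr0 eq_sym.
  by rewrite [k == m]eq_sym (negPf mk) mulr0 mul0r.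
have := M_lor (row i Q) (row j Q); rewrite !fE (negPf ij) !eqxx !mulr1 mulr0.
have dj_lt0 : d 0 j < 0 := jN.
by move=> /(_ iN); rewrite expr0n /= leNgt nmulr_rgt0 // dj_lt0.
Qed.

(** In an orthonormal eigenbasis of M, the coordinates with eigenvalue 0 do not occur
    in N, and every other product of two coordinates is bounded by the corresponding
    terms of M. *)
Lemma psd_dominates M N : M^T = M -> N^T = N ->
  (forall x, 0 <= bform M x x) -> (forall x, x *m M = 0 -> x *m N = 0) ->
  exists2 c, 0 <= c & forall x, `|bform N x x| <= c * bform M x x.
Proof.
move=> M_sym N_sym M_ge0 kerMN; have [Q [d [QQ ME]]] := sym_diag M_sym.
have QQ' : Q^T *m Q = 1%:M by apply: mulmx1C.
have d_ge0 i : 0 <= d 0 i.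
  have := M_ge0 (row i Q); rewrite ME bform_diag -!row_mul QQ.
  rewrite (bigD1 i) //= big1 => [|j ji]; rewrite !mxE ?eqxx ?mulr1 ?addr0 //.
  by rewrite [i == j]eq_sym (negPf ji) mulr0.
pose N' := Q *m N *m Q^T.
have N'_sym : N'^T = N' by rewrite !trmx_mul trmxK N_sym mulmxA.
have N'0 i j : d 0 i = 0 -> N' i j = 0.
  move=> di0; have : row i Q *m M = 0.
    rewrite ME -row_mul !mulmxA QQ mul1mx row_mul row_diag_mx di0.
    by rewrite scale0r mul0mx.
  move=> /kerMN riN; have : row i N' = 0 by rewrite /N' -mulmxA row_mul mulmxA riN mul0mx.
  by move=> /rowP/(_ j); rewrite !mxE.
pose c i j := `|N' i j| * ((d 0 i)^-1 + (d 0 j)^-1).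
have c_ge0 i j : 0 <= c i j by rewrite mulr_ge0 // addr_ge0 ?invr_ge0.
exists (\sum_i \sum_j c i j).
  by apply: sumr_ge0 => i _; apply: sumr_ge0.
move=> x; pose z := x *m Q^T.
have -> : bform N x x = \sum_i \sum_j z 0 i * N' i j * z 0 j.
  have -> : bform N x x = bform N' z z.
    rewrite /bform /z /N' trmx_mul trmxK !mulmxA.
    by rewrite -(mulmxA x Q^T Q) QQ' mulmx1 -(mulmxA _ Q^T Q) QQ' mulmx1.
  rewrite bformE exchange_big /=; apply: eq_bigr => j _.
  by rewrite mxE mulr_suml.
have -> : bform M x x = \sum_i d 0 i * z 0 i ^+ 2.
  by rewrite ME bform_diag; apply: eq_bigr => i _; rewrite -mulrA expr2.
set F := \sum_i d 0 i * _.
have F_le i : d 0 i * z 0 i ^+ 2 <= F.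
  by rewrite /F (bigD1 i) //= lerDl sumr_ge0 // => j _; rewrite mulr_ge0 ?sqr_ge0.
rewrite mulr_suml (le_trans (ler_norm_sum _ _ _)) //; apply: ler_sum => i _.
rewrite mulr_suml (le_trans (ler_norm_sum _ _ _)) //; apply: ler_sum => j _.
have [di0|di_neq0] := eqVneq (d 0 i) 0.
  by rewrite N'0 // mulr0 mul0r normr0 mulr_ge0 // (le_trans _ (F_le i)) // mulr_ge0 ?sqr_ge0.
have [dj0|dj_neq0] := eqVneq (d 0 j) 0.
  have -> : N' i j = 0 by rewrite -N'_sym [LHS]mxE N'0.
  rewrite mulr0 mul0r normr0 mulr_ge0 //.
  by rewrite (le_trans _ (F_le i)) // mulr_ge0 ?sqr_ge0.
rewrite !normrM /c -mulrA [`|z 0 i| * _]mulrC -!mulrA ler_wpM2l // mulrDl.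
have di_gt0 : 0 < d 0 i by rewrite lt_def di_neq0 d_ge0.
have dj_gt0 : 0 < d 0 j by rewrite lt_def dj_neq0 d_ge0.
have zi : z 0 i ^+ 2 <= (d 0 i)^-1 * F by rewrite ler_pdivlMl.
have zj : z 0 j ^+ 2 <= (d 0 j)^-1 * F by rewrite ler_pdivlMl.
apply: le_trans (lerD zi zj).
rewrite -(real_normK (num_real (z 0 i))) -(real_normK (num_real (z 0 j))).
have := normr_ge0 (z 0 i); have := normr_ge0 (z 0 j).
set a := `|z 0 i|; set b := `|z 0 j| => b0 a0.
have := sqr_ge0 (a - b); have := mulr_ge0 a0 b0; nra.
Qed.

End Inertia.

(** * Connected graphs and kernels of well-signed matrices *)

Definition linked n (G : sgraph n) (A : {set 'I_n}) (x y : 'I_n) : bool :=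
  connect [rel a b | [&& a \in A, b \in A & G a b]] x y.

Section Linked.
Variables (n : nat) (G : sgraph n).
Implicit Types (A B S : {set 'I_n}) (x y : 'I_n).

Lemma linked_ind A (P : 'I_n -> Prop) x y : linked G A x y -> P x ->
  (forall a b, a \in A -> b \in A -> G a b -> P a -> P b) -> P y.
Proof.
move=> /connectP[p p_path ->] Px P_step.
elim: p x Px p_path => [//|b p IHp] x Px /= /andP[/and3P[xA bA xb] p_path].
exact: IHp (P_step _ _ xA bA xb Px) p_path.
Qed.

Lemma linked1 A x y : x \in A -> y \in A -> G x y -> linked G A x y.
Proof. by move=> xA yA xy; apply: connect1; rewrite /= xA yA xy. Qed.

Lemma linked_refl A x : linked G A x x.
Proof. exact: connect0. Qed.

Lemma linked_trans A y x z : linked G A x y -> linked G A y z -> linked G A x z.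
Proof. exact: connect_trans. Qed.

Lemma linked_sym A x y : linked G A x y = linked G A y x.
Proof.
apply: sym_connect_sym => a b /=.
by rewrite andbCA adj_sym.
Qed.

Lemma linkedS A B x y : A \subset B -> linked G A x y -> linked G B x y.
Proof.
move=> /fintype.subsetP AB; apply: connect_sub => a b /= /and3P[aA bA ab].
by apply: linked1; rewrite // AB.
Qed.

Lemma subset_setC2 A x y : x \notin A -> y \notin A -> A \subset ~: [set x; y].
Proof.
move=> xA yA; apply/fintype.subsetP => k kA; rewrite !inE negb_or.
by apply/andP; split; [apply: contraNneq xA|apply: contraNneq yA] => <-.
Qed.

Lemma adj_neq x y : G x y -> x != y.
Proof. by apply: contraTneq => ->; rewrite adj_irr. Qed.

Hypothesis G_2conn : two_connected G.

Lemma linked_del1 v x y : x != v -> y != v -> linked G (~: [set v]) x y.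
Proof.
by move=> xv yv; apply: (G_2conn.2 [set v]); rewrite ?cards1 ?inE.
Qed.

Lemma linked_all x y : linked G [set: 'I_n] x y.
Proof.
by rewrite -finset.setC0; apply: (G_2conn.2 finset.set0); rewrite ?cards0 ?inE.
Qed.

End Linked.

Lemma exists_max (R : realDomainType) (T : finType) (P : pred T) (f : T -> R) x :
  P x -> exists2 y, P y & forall z, P z -> f z <= f y.
Proof. by move=> Px; case: (arg_maxP f Px) => y Py y_max; exists y. Qed.

Section WellSigned.
Variables (R : realType) (n : nat) (G : sgraph n).
Hypothesis G_2conn : two_connected G.
Implicit Types (M : 'M[R]_n) (w x y z : 'rV[R]_n).

Lemma offdiag_le0 M i j : G_matrix G M -> well_signed G M -> i != j -> M i j <= 0.
Proof.
move=> [_ M0] M_ws ij; have [/M_ws/ltW //|/M0 ->//] := boolP (G i j).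
Qed.

Lemma corank_sym M : M^T = M -> corank M = \rank (kermx M).
Proof. by move=> M_sym; rewrite /corank /nullspace M_sym. Qed.

Lemma kernel_vector_vanishing_at M i : M^T = M -> (2 <= corank M)%N ->
  exists w, [/\ w != 0, w *m M = 0 & w 0 i = 0].
Proof.
move=> M_sym; rewrite corank_sym // => rk.
have := mxrank_mul_ker (kermx M) (delta_mx i 0 : 'cV[R]_n).
set K := (_ :&: _)%MS => rkE.
have K_neq0 : K != 0.
  rewrite -mxrank_eq0; apply: contraTneq rk => K0.
  by rewrite -rkE K0 addn0 -ltnNge ltnS rank_leq_col.
have /rowV0Pn[w wK w_neq0] := K_neq0.
exists w; split=> //; first by apply/sub_kermxP/(submx_trans wK)/capmxSl.
have /sub_kermxP : (w <= kermx (delta_mx i 0 : 'cV[R]_n))%MS.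
  exact/(submx_trans wK)/capmxSr.
by rewrite -colE => /matrixP/(_ 0 0); rewrite !mxE.
Qed.

Section Admissible.
Variable M : 'M[R]_n.
Hypotheses (M_G : G_matrix G M) (M_ws : well_signed G M).

(** The kernel equation at a node where z vanishes is a sum of nonpositive
    terms, so z vanishes at all its neighbours. *)
Lemma nonneg_kernel_vector z i : z *m M = 0 -> (forall j, 0 <= z 0 j) ->
  z 0 i = 0 -> z = 0.
Proof.
move=> zM z_ge0 zi0; apply/rowP => j; rewrite [RHS]mxE.
apply: (linked_ind (P := fun k => z 0 k = 0) (linked_all G_2conn i j) zi0) => a b _ _ ab za0.
have /rowP/(_ a)/eqP := zM; rewrite !mxE -oppr_eq0 -sumrN.
rewrite psumr_eq0 => [/allP/(_ b (mem_index_enum _))/=|k _]; last first.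
  have [->|ka] := eqVneq k a; first by rewrite za0 mul0r oppr0.
  by rewrite oppr_ge0 mulr_ge0_le0 // (offdiag_le0 M_G).
rewrite oppr_eq0 mulf_eq0 (lt_eqF (M_ws _)) ?orbF; first by move/eqP.
by rewrite adj_sym.
Qed.

(** If z were negative everywhere, a multiple of z subtracted from another kernel vector
    would give a nonnegative kernel vector with a zero. *)
Lemma kernel_vector_pos z : (2 <= corank M)%N -> z *m M = 0 -> z != 0 ->
  exists i, 0 < z 0 i.
Proof.
move=> rk zM z_neq0; apply/existsP; apply: contraT; rewrite negb_exists.
move=> /forallP z_le0; have {}z_le0 j : z 0 j <= 0 by have := z_le0 j; rewrite -leNgt.
have z_lt0 j : z 0 j < 0.
  rewrite lt_def z_le0 andbT eq_sym; apply: contra z_neq0 => /eqP zj0.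
  rewrite -oppr_eq0; apply/eqP/(@nonneg_kernel_vector _ j).
  - by rewrite mulNmx zM oppr0.
  - by move=> k; rewrite mxE oppr_ge0.
  - by rewrite mxE zj0 oppr0.
have i0 : 'I_n by have := G_2conn.1; case: (n) => // m _; exact: ord0.
have [w [w_neq0 wM w_i0]] := kernel_vector_vanishing_at i0 (proj1 M_G) rk.
(* The extreme ratio makes w - s z nonnegative and zero at j. *)
have [j _ j_min] :=
  @exists_max _ _ xpredT (fun j => w 0 j / z 0 j) i0 isT.
pose s := w 0 j / z 0 j.
have ws0 : w - s *: z = 0.
  apply: (@nonneg_kernel_vector _ j).
  - by rewrite mulmxBl -scalemxAl wM zM scaler0 subr0.
  - move=> k; have := j_min k isT; rewrite -/s !mxE subr_ge0.
    by rewrite ler_ndivrMr.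
  - by rewrite !mxE /s divfK ?subrr // lt_eqF.
have s0 : s = 0.
  have /rowP/(_ i0)/eqP := ws0; rewrite !mxE w_i0 sub0r oppr_eq0 mulf_eq0.
  by rewrite (lt_eqF (z_lt0 _)) orbF => /eqP.
by move: w_neq0 ws0; rewrite s0 scale0r subr0 => /eqP.
Qed.

(** Replacing a kernel vector by its absolute value does not increase the form. If the
    form were positive semidefinite, the result would be a nonnegative kernel vector,
    and it may be taken with a zero since the corank is at least 2. *)
Lemma negative_vector : (2 <= corank M)%N -> exists e, bform M e e < 0.
Proof.
move=> rk; apply: contrapT => no_e.
have M_ge0 y : 0 <= bform M y y by rewrite leNgt; apply/negP => ?; apply: no_e; exists y.
have i0 : 'I_n by have := G_2conn.1; case: (n) => // m _; exact: ord0.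
have [w [w_neq0 wM w_i0]] := kernel_vector_vanishing_at i0 (proj1 M_G) rk.
pose y : 'rV[R]_n := \row_j `|w 0 j|.
have y_le0 : bform M y y <= bform M w w.
  rewrite !bformE; apply: ler_sum => j _; rewrite !mxE !mulr_suml.
  apply: ler_sum => i _; rewrite !mxE.
  have [->|ij] := eqVneq i j; first last.
    rewrite mulrAC -normrM [X in _ <= X]mulrAC.
    by rewrite ler_wnM2r ?ler_norm // (offdiag_le0 M_G).
  by rewrite mulrAC -normrM [X in _ <= X]mulrAC ger0_norm // -expr2 sqr_ge0.
have y0 : bform M y y = 0.
  by apply: le_anti; rewrite M_ge0 andbT (le_trans y_le0) // bform_ker.
have yM := psd_isotropic (proj1 M_G) M_ge0 y0.
have : y = 0.
  by apply: (@nonneg_kernel_vector _ i0) => // [j|]; rewrite mxE ?w_i0 ?normr0.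
move=> y_eq0; case/eqP: w_neq0; apply/rowP => j.
by have /rowP/(_ j)/eqP := y_eq0; rewrite !mxE normr_eq0 => /eqP.
Qed.

Lemma corank_le_kappa : lorentz M -> (2 <= corank M)%N ->
  (corank M <= kappa R G)%N.
Proof.
move=> M_lor rk; have [e e_lt0] := negative_vector rk.
have M_adm : admissible G M.
  by split=> //; apply: one_negative_of_lorentz e_lt0; case: M_G.
have rk_n : (corank M < n.+1)%N by rewrite ltnS rank_leq_row.
apply: (@leq_bigmax_cond _ _ (fun d : 'I_n.+1 => d : nat) (Ordinal rk_n)).
by apply/asboolP; exists M.
Qed.

End Admissible.
End WellSigned.

(** * A matrix of corank 3 from three linked neighbours *)

Section Elimination.
Variables (R : realType) (n : nat) (G : sgraph n) (T : {set 'I_n}).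

Definition inner_adj : 'M[R]_n :=
  \matrix_(i, j) [&& i \notin T, j \notin T & G i j]%:R.

(** The matrix to be placed on the nodes outside T; the diagonal n + 1 exceeds every
    row sum of the adjacency matrix, which makes it positive definite with a
    nonnegative inverse. On T it is only a multiple of the identity, so that inverses
    can be taken without changing the index set. *)
Definition inner_mx : 'M[R]_n := n.+1%:R%:M - inner_adj.

Definition boundary_mx : 'M[R]_n :=
  \matrix_(i, j) [&& i \notin T, j \in T & G i j]%:R.

(** Column t is the extension of the unit vector at t to the outside of T that is
    harmonic for inner_mx. *)
Definition harmonic_mx : 'M[R]_n := invmx inner_mx *m boundary_mx.

Definition inner_proj : 'M[R]_n := diag_mx (\row_i (i \notin T)%:R).

Definition residual_mx : 'M[R]_n := inner_proj - harmonic_mx.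

(** Minus the change of the block at T when the nodes outside T are eliminated. *)
Definition response_mx : 'M[R]_n := boundary_mx^T *m harmonic_mx.

Lemma inner_adj_sym : inner_adj^T = inner_adj.
Proof.
apply/matrixP => i j; rewrite !mxE adj_sym.
by case: (i \in T); case: (j \in T).
Qed.

Lemma inner_mx_sym : inner_mx^T = inner_mx.
Proof. by rewrite linearB /= tr_scalar_mx inner_adj_sym. Qed.

(** Completing squares edge by edge. *)
Lemma inner_mx_pos (x : 'rV[R]_n) :
  \sum_i x 0 i ^+ 2 <= bform inner_mx x x.
Proof.
have -> : bform inner_mx x x =
   \sum_i (x 0 i ^+ 2 + \sum_j ((x 0 i ^+ 2 + x 0 j ^+ 2) / 2 -
      inner_adj i j * x 0 i * x 0 j)).
  have s2 : \sum_i \sum_j ((x 0 i ^+ 2 + x 0 j ^+ 2) / 2) =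
      n%:R * \sum_i x 0 i ^+ 2.
    transitivity (\sum_(i < n) \sum_(j < n) x 0 i ^+ 2 / 2 +
                  \sum_(i < n) \sum_(j < n) x 0 j ^+ 2 / 2).
      rewrite -big_split; apply: eq_bigr => i _; rewrite -big_split.
      by apply: eq_bigr => j _; rewrite mulrDl.
    rewrite [X in _ + X]exchange_big /= -big_split /= mulr_sumr.
    by apply: eq_bigr => i _; rewrite sumr_const card_ord -mulr_natl; field.
  rewrite big_split /=.
  under [X in _ = _ + X]eq_bigr => i _ do rewrite sumrB.
  rewrite sumrB s2 bformE exchange_big /= addrA.
  have -> : \sum_i x 0 i ^+ 2 + n%:R * \sum_i x 0 i ^+ 2 =
      \sum_j n.+1%:R * x 0 j ^+ 2.
    by rewrite -[X in X + _]mul1r -mulrDl -mulr_sumr nat1r.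
  rewrite -sumrB; apply: eq_bigr => j _.
  rewrite /inner_mx mulmxBr mul_mx_scalar mxE [X in (X + _) * _]mxE.
  rewrite [X in (_ + X) * _]mxE [X in - X]mxE mulrBl mulr_suml -mulrA -expr2.
  by congr (_ - _); apply: eq_bigr => i _; rewrite [x 0 i * _]mulrC.
rewrite ler_sum // => i _; rewrite lerDl sumr_ge0 // => j _.
rewrite mxE; case: [&& _, _ & _]; rewrite ?mul1r ?mul0r.
  by have := sqr_ge0 (x 0 i - x 0 j); nra.
by have := sqr_ge0 (x 0 i); have := sqr_ge0 (x 0 j); lra.
Qed.

Lemma inner_mx_unit : inner_mx \in unitmx.
Proof.
rewrite -row_free_unit -kermx_eq0; apply/rowV0P => x /sub_kermxP xC.
have := inner_mx_pos x; rewrite bform_ker // => x_le0.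
apply/rowP => i; rewrite [RHS]mxE; apply/eqP; rewrite -sqrf_eq0.
have /psumr_eq0P x0 : \sum_i x 0 i ^+ 2 = 0.
  by apply: le_anti; rewrite x_le0 sumr_ge0 // => j _; rewrite sqr_ge0.
by rewrite x0 // => j _; rewrite sqr_ge0.
Qed.

Lemma inner_harmonic : inner_mx *m harmonic_mx = boundary_mx.
Proof. by rewrite mulKVmx // inner_mx_unit. Qed.

Lemma harmonicE i j : n.+1%:R * harmonic_mx i j =
  boundary_mx i j + \sum_k inner_adj i k * harmonic_mx k j.
Proof.
rewrite -inner_harmonic /inner_mx mulmxBl mul_scalar_mx.
have E1 (A B : 'M[R]_n) : (n.+1%:R *: A - B) i j = n.+1%:R * A i j - B i j.
  by rewrite !mxE.
by rewrite E1 [(inner_adj *m _) i j]mxE subrK.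
Qed.

(** The minimum principle: at a node where a negative minimum is attained, the diagonal
    term outweighs the sum over the neighbours. *)
Lemma harmonic_ge0 i j : 0 <= harmonic_mx i j.
Proof.
have [k _ k_max] := @exists_max R _ xpredT (fun k => - harmonic_mx k j) i isT.
have {k_max} k_min m : harmonic_mx k j <= harmonic_mx m j.
  by rewrite -lerN2 k_max.
apply: le_trans (k_min i); rewrite leNgt; apply/negP => k_lt0.
have /eqP := harmonicE k j; rewrite lt_eqF //.
have n1 : \sum_(m < n) harmonic_mx k j = n%:R * harmonic_mx k j.
  by rewrite sumr_const card_ord mulr_natl.
apply: (@lt_le_trans _ _ (n%:R * harmonic_mx k j)).
  by rewrite -addn1 natrD mulrDl mul1r gtrDl.
rewrite -n1 -[X in X <= _]add0r lerD //; first by rewrite mxE ler0n.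
apply: ler_sum => m _; rewrite [inner_adj _ _]mxE; case: [&& _, _ & _].
  by rewrite mul1r.
by rewrite mul0r ltW.
Qed.

Lemma harmonic_boundary i j : i \in T -> harmonic_mx i j = 0.
Proof.
move=> iT; have := harmonicE i j; rewrite [boundary_mx _ _]mxE iT /= add0r big1 => [/eqP|k _].
  by rewrite mulf_eq0 pnatr_eq0 => /eqP.
by rewrite [inner_adj _ _]mxE iT mul0r.
Qed.

Lemma response_ge0 s t : 0 <= response_mx s t.
Proof.
rewrite mxE sumr_ge0 // => i _; rewrite mulr_ge0 ?harmonic_ge0 //.
by rewrite !mxE ler0n.
Qed.

Lemma response_sym : response_mx^T = response_mx.
Proof.
rewrite /response_mx /harmonic_mx !trmx_mul trmxK trmx_inv inner_mx_sym.
by rewrite mulmxA.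
Qed.

(** A path from s to t whose interior avoids T carries the positive value at t of
    the harmonic extension all the way to s. *)
Lemma response_gt0 (A : {set 'I_n}) s t : s \in T -> t \in T -> s != t ->
  A :&: T \subset [set s; t] -> linked G A s t ->
  0 < response_mx s t + (G s t)%:R.
Proof.
move=> sT tT st AT s_t; rewrite lt_def addr_ge0 ?response_ge0 ?ler0n // andbT.
apply/negP; rewrite paddr_eq0 ?response_ge0 ?ler0n // pnatr_eq0 eqb0.
case/andP; rewrite mxE psumr_eq0 => [/allP s0 /negP st_nadj|i _]; last first.
  by rewrite mulr_ge0 ?harmonic_ge0 // !mxE ler0n.
have inA a : a \in A -> a \in T -> a = s \/ a = t.
  move=> aA aT; have /fintype.subsetP/(_ a) := AT.
  by rewrite !inE aA aT => /(_ isT)/orP[] /eqP; [left|right].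
have : t = s \/ (t \notin T /\ harmonic_mx t t = 0); last first.
  by case=> [ts|[]]; [rewrite ts eqxx in st|rewrite tT].
apply: (linked_ind (P := fun a => a = s \/ (a \notin T /\ harmonic_mx a t = 0)) s_t).
  by left.
move=> a b aA bA ab [a_s|[aT a0]].
  rewrite {}a_s in ab; have [bT|bT] := boolP (b \in T).
    by case: (inA b bA bT) => [|b_t]; [left|rewrite -b_t ab in st_nadj].
  right; split=> //; have := s0 b (mem_index_enum _).
  by rewrite /= mxE [boundary_mx _ _]mxE bT sT adj_sym ab mul1r => /eqP.
have := harmonicE a t; rewrite a0 mulr0 => /esym/eqP.
have pos k : 0 <= inner_adj a k * harmonic_mx k t.
  by rewrite mulr_ge0 ?harmonic_ge0 // mxE ler0n.
rewrite paddr_eq0 ?sumr_ge0 //; last by rewrite mxE ler0n.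
case/andP; rewrite [boundary_mx _ _]mxE aT tT pnatr_eq0 eqb0 /= => at_nadj.
rewrite psumr_eq0 // => /allP/(_ b (mem_index_enum _)) /=.
rewrite [inner_adj _ _]mxE aT ab andbT; have [bT _|bT] := boolP (b \in T).
  by case: (inA b bA bT) => [|b_t]; [left|rewrite -b_t ab in at_nadj].
by rewrite mul1r => /eqP; right.
Qed.

Lemma rank_inner_proj : (\rank inner_proj <= n - #|T|)%N.
Proof.
pose B : 'M[R]_(#|~: T|, n) := \matrix_(k, j) (enum_val k == j)%:R.
have -> : inner_proj = B^T *m B.
  apply/matrixP => i j; rewrite !mxE.
  under eq_bigr => k _ do rewrite !mxE -natrM mulnb.
  rewrite -(big_enum_val (A := mem (~: T)) (fun x => ((x == i) && (x == j))%:R)).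
  rewrite big_mkcond (bigD1 i) //= big1 ?addr0 => [|k /negPf ->]; last by case: ifP.
  by rewrite !inE eqxx; case: (i \in T); case: (i == j).
apply: leq_trans (mulmx_max_rank _ _) _.
have cT := cardsC T; rewrite card_ord in cT.
by rewrite leq_subRL ?cT //; have := leq_addr #|~: T| #|T|; rewrite cT.
Qed.

End Elimination.

Section EliminationForm.
Variables (R : realType) (n : nat) (G : sgraph n) (T : {set 'I_n}).

Local Notation C := (inner_mx R G T).
Local Notation Y := (residual_mx R G T).

Lemma inner_proj_harmonic :
  inner_proj R T *m harmonic_mx R G T = harmonic_mx R G T.
Proof.
apply/matrixP => i j; rewrite mul_diag_mx mxE.
have [iT|iT] := boolP (i \in T); last by rewrite mxE iT mul1r.
by rewrite harmonic_boundary // mulr0.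
Qed.

Lemma response_out i j : ~~ ((i \in T) && (j \in T)) -> response_mx R G T i j = 0.
Proof.
wlog jT : i j / j \notin T => [th|_].
  rewrite negb_and => /orP[iT|jT]; last by rewrite th // negb_and jT orbT.
  by rewrite -response_sym mxE th // negb_and iT orbT.
by rewrite -response_sym [LHS]mxE [LHS]mxE big1 // => k _; rewrite !mxE (negPf jT) andbF mul0r.
Qed.

(** Y applied to a vector is its deviation from the harmonic extension of its values
    on T. The mixed terms simplify because inner_mx maps harmonic_mx to boundary_mx. *)
Lemma residual_formE i j : i != j -> (Y^T *m C *m Y) i j =
  if (i \in T) && (j \in T) then response_mx R G T i j else - (G i j)%:R.
Proof.
move=> ij; have PT : (inner_proj R T)^T = inner_proj R T by rewrite tr_diag_mx.
have KC : (harmonic_mx R G T)^T *m C = (boundary_mx R G T)^T.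
  by rewrite -inner_mx_sym -trmx_mul inner_harmonic.
have KB : (harmonic_mx R G T)^T *m boundary_mx R G T = response_mx R G T.
  by rewrite -response_sym /response_mx [RHS]trmx_mul trmxK.
have YT : Y^T = inner_proj R T - (harmonic_mx R G T)^T.
  by rewrite /residual_mx linearB /= PT.
have CY : C *m Y = C *m inner_proj R T - boundary_mx R G T.
  by rewrite /residual_mx mulmxBr inner_harmonic.
have -> : Y^T *m C *m Y = inner_proj R T *m C *m inner_proj R T
    - inner_proj R T *m boundary_mx R G T
    - ((boundary_mx R G T)^T *m inner_proj R T - response_mx R G T).
  rewrite -mulmxA CY YT mulmxBl [inner_proj R T *m (_ - _)]mulmxBr.
  by rewrite [(harmonic_mx R G T)^T *m (_ - _)]mulmxBr !mulmxA KC KB.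
have subE (A B D E : 'M[R]_n) : (A - B - (D - E)) i j =
    A i j - B i j - (D i j - E i j) by rewrite !mxE.
rewrite subE; have := @response_out i j; move: (response_mx R G T i j) => r r0.
rewrite mul_mx_diag !mul_diag_mx mul_mx_diag !mxE (negPf ij) mulr0n sub0r adj_sym.
by case: (i \in T) r0; case: (j \in T) => r0; case: (G _ _);
  rewrite /= ?(mulr0n, mulr1n) //; try rewrite (r0 isT); ring.
Qed.

Lemma rank_residual : (\rank (Y^T *m C *m Y) <= n - #|T|)%N.
Proof.
have -> : Y = inner_proj R T *m (1%:M - harmonic_mx R G T).
  by rewrite mulmxBr mulmx1 inner_proj_harmonic.
apply: leq_trans (rank_inner_proj R T).
by rewrite (leq_trans (mxrankM_maxr _ _)) // mxrankM_maxl.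
Qed.

Lemma residual_form_ge0 (x : 'rV[R]_n) : 0 <= bform (Y^T *m C *m Y) x x.
Proof.
have -> : bform (Y^T *m C *m Y) x x = bform C (x *m Y^T) (x *m Y^T).
  by rewrite /bform trmx_mul trmxK !mulmxA.
by apply: le_trans (inner_mx_pos _ _ _); apply: sumr_ge0 => i _; rewrite sqr_ge0.
Qed.

Lemma residual_form_sym : (Y^T *m C *m Y)^T = Y^T *m C *m Y.
Proof. by rewrite !trmx_mul trmxK inner_mx_sym mulmxA. Qed.

End EliminationForm.

(** Let T consist of v and three neighbours. Any matrix A - w^T w, with A the form of
    deviation from harmonicity and w supported on T, has at most one negative
    eigenvalue and corank at least |T| - 1 = 3. Its entries outside T x T are those of
    a well-signed matrix. On T they are response - w_i w_j; by the paths, the response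
    can be made positive for the three pairs of neighbours, and then w_1, w_2, w_3
    solve w_i w_j = response + adjacency. The remaining value w_v only has to be large,
    because v is adjacent to the three others. *)
Lemma three_neighbours (R : realType) (n : nat) (G : sgraph n) v r1 r2 r3 :
  two_connected G -> kappa R G = 2%N ->
  G v r1 -> G v r2 -> G v r3 -> r1 != r2 -> r1 != r3 -> r2 != r3 ->
  linked G (~: [set v; r3]) r1 r2 -> linked G (~: [set v; r1]) r2 r3 ->
  linked G (~: [set v; r2]) r1 r3 -> False.
Proof.
move=> G_2conn G_kappa vr1 vr2 vr3 r12 r13 r23 l12 l23 l13.
pose T : {set 'I_n} := [set v; r1; r2; r3].
have v1 := adj_neq vr1; have v2 := adj_neq vr2; have v3 := adj_neq vr3.
have [vT r1T r2T r3T] : [/\ v \in T, r1 \in T, r2 \in T & r3 \in T].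
  by split; rewrite !inE eqxx ?orbT.
pose E := response_mx R G T.
pose F s t := E s t + (G s t)%:R.
have E_sym s t : E s t = E t s by rewrite /E -[in LHS]response_sym [LHS]mxE.
have F12 : 0 < F r1 r2.
  apply: response_gt0 l12 => //; apply/fintype.subsetP => a; rewrite !inE.
  by case: (a == v); case: (a == r1); case: (a == r2); case: (a == r3).
have F23 : 0 < F r2 r3.
  apply: response_gt0 l23 => //; apply/fintype.subsetP => a; rewrite !inE.
  by case: (a == v); case: (a == r1); case: (a == r2); case: (a == r3).
have F13 : 0 < F r1 r3.
  apply: response_gt0 l13 => //; apply/fintype.subsetP => a; rewrite !inE.
  by case: (a == v); case: (a == r1); case: (a == r2); case: (a == r3).
pose w1 := Num.sqrt (F r1 r2 * F r1 r3 / F r2 r3).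
pose w2 := F r1 r2 / w1; pose w3 := F r1 r3 / w1.
have w1_sqr : w1 ^+ 2 = F r1 r2 * F r1 r3 / F r2 r3.
  by rewrite sqr_sqrtr // divr_ge0 ?mulr_ge0 // ltW.
have w1_gt0 : 0 < w1 by rewrite sqrtr_gt0 divr_gt0 // mulr_gt0.
have w2_gt0 : 0 < w2 by rewrite divr_gt0.
have w3_gt0 : 0 < w3 by rewrite divr_gt0.
have w12 : w1 * w2 = F r1 r2 by rewrite mulrC divfK // gt_eqF.
have w13 : w1 * w3 = F r1 r3 by rewrite mulrC divfK // gt_eqF.
have w23 : w2 * w3 = F r2 r3.
  have -> : w2 * w3 = F r1 r2 * F r1 r3 / w1 ^+ 2.
    by rewrite /w2 /w3; field; rewrite gt_eqF.
  by rewrite w1_sqr; field; rewrite !gt_eqF.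
pose wv := (1 + E v r1) / w1 + (1 + E v r2) / w2 + (1 + E v r3) / w3.
have E_ge0 s t : 0 <= E s t by exact: response_ge0.
have t_ge0 s (u : R) : 0 < u -> 0 <= (1 + E v s) / u.
  by move=> u_gt0; rewrite divr_ge0 ?addr_ge0 // ltW.
have wv_large s (u : R) : 0 < u -> (1 + E v s) / u <= wv -> E v s < wv * u.
  by move=> u_gt0; rewrite ler_pdivrMr //; apply: lt_le_trans; rewrite ltrDr.
have wv1 : E v r1 < wv * w1.
  by apply: wv_large => //; rewrite /wv -addrA lerDl addr_ge0 ?t_ge0.
have wv2 : E v r2 < wv * w2.
  by apply: wv_large => //; rewrite /wv addrAC lerDr addr_ge0 ?t_ge0.
have wv3 : E v r3 < wv * w3.
  by apply: wv_large => //; rewrite /wv lerDr addr_ge0 ?t_ge0.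
pose w : 'rV[R]_n := \row_i
  (if i == v then wv else if i == r1 then w1 else if i == r2 then w2 else
   if i == r3 then w3 else 0).
pose A := (residual_mx R G T)^T *m inner_mx R G T *m residual_mx R G T.
pose M := A - w^T *m w.
have ME i j : M i j = A i j - w 0 i * w 0 j.
  by rewrite /M [LHS]mxE [X in _ + X]mxE [X in _ - X]mxE big_ord1 [_^T _ _]mxE.
have A_sym : A^T = A by exact: residual_form_sym.
have M_sym : M^T = M by rewrite linearB /= A_sym trmx_mul trmxK.
have wE : [/\ w 0 v = wv, w 0 r1 = w1, w 0 r2 = w2 & w 0 r3 = w3].
  by split; rewrite mxE ?eqxx // ![_ == v]eq_sym ?(negPf v1, negPf v2, negPf v3)
    // ![_ == r1]eq_sym ?(negPf r12, negPf r13) // eq_sym (negPf r23).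
have [w_v w_1 w_2 w_3] := wE.
(* The sign pattern required of the entry at i, j. *)
pose ok i j := if G i j then M i j < 0 else M i j == 0.
have M_C i j : M i j = M j i by have /matrixP/(_ j i) := M_sym; rewrite [LHS]mxE.
have ok_sym i j : ok i j -> ok j i by rewrite /ok [M i j]M_C [G i j]adj_sym.
have w_out i : i \notin T -> w 0 i = 0.
  rewrite !inE !negb_or mxE -!andbA.
  by case/and4P => /negPf-> /negPf-> /negPf-> /negPf->.
have ok_out i j : i \notin T -> i != j -> ok i j.
  move=> iT ij; rewrite /ok ME w_out // mul0r subr0 residual_formE // (negPf iT).
  by case: (G i j); rewrite ?oppr0 ?eqxx ?oppr_lt0 ?ltr01.
have ok_F i j wi wj : i \in T -> j \in T -> i != j -> w 0 i = wi -> w 0 j = wj ->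
    wi * wj = F i j -> ok i j.
  move=> iT jT ij wiE wjE wF; rewrite /ok ME residual_formE // iT jT wiE wjE wF.
  rewrite /F opprD addrA subrr sub0r.
  by case: (G i j); rewrite ?oppr0 ?eqxx ?oppr_lt0 ?ltr01.
have ok_v i wi : i \in T -> v != i -> G v i -> w 0 i = wi -> E v i < wv * wi -> ok v i.
  move=> iT vi Gvi wiE Ewi; rewrite /ok Gvi ME residual_formE // vT iT w_v wiE.
  by rewrite subr_lt0.
have M_ok i j : i != j -> ok i j.
  move=> ij; have [iT|/ok_out->//] := boolP (i \in T).
  have [jT|jT] := boolP (j \in T); last by apply/ok_sym/ok_out; rewrite // eq_sym.
  have okv1 := ok_v _ _ r1T v1 vr1 w_1 wv1.
  have okv2 := ok_v _ _ r2T v2 vr2 w_2 wv2.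
  have okv3 := ok_v _ _ r3T v3 vr3 w_3 wv3.
  have ok12 := ok_F _ _ _ _ r1T r2T r12 w_1 w_2 w12.
  have ok13 := ok_F _ _ _ _ r1T r3T r13 w_1 w_3 w13.
  have ok23 := ok_F _ _ _ _ r2T r3T r23 w_2 w_3 w23.
  move: iT jT ij; rewrite !inE -!orbA.
  by do 2![case/or4P => /eqP->]; rewrite ?eqxx // => _; auto.
have M_G : G_matrix G M.
  by split=> // i j /M_ok; rewrite /ok; case: (G i j) => // /eqP.
have M_ws : well_signed G M.
  by move=> i j ij; have := M_ok i j (adj_neq ij); rewrite /ok ij.
have M_lor : lorentz M.
  apply: (@lorentz_hyperplane _ _ _ (fun x => (x *m w^T) 0 0)) => //.
    by move=> a x y; rewrite mulmxDl -scalemxAl !mxE.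
  move=> x xw0; rewrite /M bformDM -scaleN1r bformZM.
  have -> : bform (w^T *m w) x x = 0.
    rewrite /bform mulmxA [x *m w^T]mx11_scalar xw0.
    by rewrite mul_scalar_mx scale0r mul0mx mxE.
  by rewrite mulr0 addr0 residual_form_ge0.
have cT : #|T| = 4%N.
  have /card_uniqP vr4 : uniq [:: v; r1; r2; r3].
    by rewrite /= !inE !negb_or v1 v2 v3 r12 r13 r23.
  by rewrite -[4%N]vr4; apply: eq_card => a; rewrite !inE -!orbA.
have rk : (3 <= corank M)%N.
  rewrite corank_sym // mxrank_ker.
  have rkM : (\rank M <= (n - 4) + 1)%N.
    apply: leq_trans (mxrank_add _ _) _; rewrite leq_add //.
      by rewrite -cT rank_residual.
    by rewrite mxrank_opp (leq_trans (mxrankM_maxl _ _)) // rank_leq_col.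
  have n4 : (4 <= n)%N by have := max_card (mem T); rewrite cT card_ord.
  by move: rkM n4; clear; lia.
have := corank_le_kappa G_2conn M_G M_ws M_lor (ltnW rk).
by rewrite G_kappa leqNgt rk.
Qed.

(** * Deformations preserving the kernel *)

Section OuterProducts.
Variables (R : realType) (n : nat).
Implicit Types (v w x y : 'rV[R]_n) (M : 'M[R]_n).

Lemma row_outer y v w : y *m (v^T *m w) = (v *m y^T) 0 0 *: w.
Proof.
rewrite mulmxA [y *m v^T]mx11_scalar mul_scalar_mx; congr (_ *: _).
by rewrite -[y in LHS]trmxK -trmx_mul mxE.
Qed.

Lemma bform_outer v w y : bform (v^T *m w) y y = (v *m y^T) 0 0 * (w *m y^T) 0 0.
Proof. by rewrite /bform row_outer -scalemxAl mxE. Qed.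

End OuterProducts.

Lemma quadratic_lt0 (R : realFieldType) (a b c d : R) : a < 0 -> 0 < d ->
  exists s, [/\ 0 < s, s <= d & a + s * b + s ^+ 2 * c < 0].
Proof.
move=> a_lt0 d_gt0; pose m := `|b| + `|c| + 1.
have m_gt0 : 0 < m by rewrite ltr_pwDr // addr_ge0.
pose s := Num.min (Num.min 1 d) (- a / (2 * m)).
have s_gt0 : 0 < s.
  by rewrite !lt_min ltr01 d_gt0 divr_gt0 ?oppr_gt0 // mulr_gt0.
have s_1 : s <= 1 by rewrite !ge_min lexx.
have s_m : s * (2 * m) <= - a by rewrite -ler_pdivlMr ?mulr_gt0 // !ge_min lexx orbT.
exists s; split=> //; first by rewrite !ge_min lexx orbT.
have sb : s * b <= s * `|b| by rewrite ler_pM2l // ler_norm.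
have sc : s ^+ 2 * c <= s * `|c|.
  rewrite expr2 -mulrA ler_pM2l //; apply: le_trans (ler_norm _) _.
  by rewrite normrM gtr0_norm // ler_piMl.
have sm : s * (2 * m) = 2 * (s * `|b| + s * `|c| + s) by rewrite /m; ring.
rewrite sm in s_m; lra.
Qed.

(** A family A0 + s A1 + s^2 A2 that starts positive semidefinite stays so for a while
    when A1 and A2 vanish on the kernel of A0: both are then dominated by A0. *)
Lemma psd_perturb (R : realType) n (A0 A1 A2 : 'M[R]_n) :
  A0^T = A0 -> A1^T = A1 -> A2^T = A2 -> (forall y, 0 <= bform A0 y y) ->
  (forall y : 'rV[R]_n, y *m A0 = 0 -> y *m A1 = 0 /\ y *m A2 = 0) ->
  exists2 d, 0 < d & forall s y, 0 <= s -> s <= d ->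
    0 <= bform A0 y y + s * bform A1 y y + s ^+ 2 * bform A2 y y.
Proof.
move=> A0_sym A1_sym A2_sym A0_ge0 kerA.
have [c1 c1_ge0 A1_le] := psd_dominates A0_sym A1_sym A0_ge0 (fun y y0 => (kerA y y0).1).
have [c2 c2_ge0 A2_le] := psd_dominates A0_sym A2_sym A0_ge0 (fun y y0 => (kerA y y0).2).
pose m := c1 + c2 + 1; have m_gt0 : 0 < m by rewrite ltr_pwDr // addr_ge0.
exists m^-1; first by rewrite invr_gt0.
move=> s y s_ge0 s_le.
have sm : s * m <= 1 by rewrite -ler_pdivlMr // mul1r.
have s_1 : s <= 1.
  by apply: le_trans s_le _; rewrite invf_le1 // lerDr addr_ge0.
set f := bform A0 y y.
have f_ge0 : 0 <= f by exact: A0_ge0.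
have := A1_le y; have := A2_le y; rewrite -/f !ler_norml => /andP[f2 _] /andP[f1 _].
have sf1 : s * (- (c1 * f)) <= s * bform A1 y y by rewrite ler_wpM2l.
have sf2 : s ^+ 2 * (- (c2 * f)) <= s ^+ 2 * bform A2 y y by rewrite ler_wpM2l ?exprn_ge0.
have c2f : s ^+ 2 * (c2 * f) <= s * (c2 * f).
  by rewrite expr2 -mulrA ler_wpM2l // ler_piMl // mulr_ge0.
have smf : s * m * f <= 1 * f by rewrite ler_wpM2r.
have : s * m * f = s * (c1 * f) + s * (c2 * f) + s * f by rewrite /m; ring.
have : 0 <= s * f by rewrite mulr_ge0.
lra.
Qed.

Section Deformation.
Variables (R : realType) (n : nat) (G : sgraph n).
Hypotheses (G_2conn : two_connected G) (G_kappa : kappa R G = 2%N).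
Variables (M N : 'M[R]_n) (U : 'M[R]_(2, n)) (e : 'rV[R]_n).
Hypotheses (M_G : G_matrix G M) (M_ws : well_signed G M) (M_lor : lorentz M).
Hypotheses (U_free : row_free U) (UM : U *m M = 0).
Hypotheses (N_sym : N^T = N) (UN : U *m N = 0).
Hypothesis N_le0 : forall i j, i != j -> N i j <= 0.
Hypothesis N_nadj : forall i j, i != j -> ~~ G i j -> N i j = 0.
Hypotheses (e_M : bform M e e < 0) (e_N : bform N e e <= 0).

Implicit Types (t s : R) (x y : 'rV[R]_n).

Let Mt t : 'M[R]_n := M + t *: N.

Let Mt_sym t : (Mt t)^T = Mt t.
Proof. by rewrite linearD linearZ /= N_sym (proj1 M_G). Qed.

Let Mt_G t : G_matrix G (Mt t).
Proof.
split=> // i j ij ij_nadj; rewrite !mxE N_nadj // (proj2 M_G) //.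
by rewrite mulr0 addr0.
Qed.

Let Mt_ws t : 0 <= t -> well_signed G (Mt t).
Proof.
move=> t_ge0 i j ij; rewrite !mxE ltr_wnDr ?M_ws // mulr_ge0_le0 // N_le0 //.
exact: adj_neq ij.
Qed.

Let e_Mt t : 0 <= t -> bform (Mt t) e e < 0.
Proof. by move=> t_ge0; rewrite bformDM bformZM ltr_wnDr // mulr_ge0_le0. Qed.

Let UMt t : U *m Mt t = 0.
Proof. by rewrite mulmxDr -scalemxAr UM UN scaler0 addr0. Qed.

Let U_ker t : (U <= kermx (Mt t))%MS.
Proof. exact/sub_kermxP. Qed.

Let Mt_corank t : 0 <= t -> lorentz (Mt t) -> corank (Mt t) = 2%N.
Proof.
move=> t_ge0 t_lor; have rkU : \rank U = 2%N by apply/eqP.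
have rk : (2 <= corank (Mt t))%N.
  by rewrite corank_sym // -rkU mxrankS.
apply/eqP; rewrite eqn_leq rk andbT -[X in (_ <= X)%N]G_kappa.
by apply: corank_le_kappa => //; exact: Mt_ws.
Qed.

Let ker_Mt t x : 0 <= t -> lorentz (Mt t) -> x *m Mt t = 0 -> x *m N = 0.
Proof.
move=> t_ge0 t_lor xM; have /eqP rkU : \rank U == 2%N by [].
have KU : (kermx (Mt t) <= U)%MS.
  by rewrite -(geq_leqif (mxrank_leqif_sup (U_ker t))) rkU -corank_sym // Mt_corank.
have /submxP[a ->] : (x <= U)%MS by apply: submx_trans KU; apply/sub_kermxP.
by rewrite -mulmxA UN mulmx0.
Qed.

(* F t is positive semidefinite if and only if M + t N has the single negative
   direction e. *)
Let F t y := bform (Mt t) e y ^+ 2 - bform (Mt t) e e * bform (Mt t) y y.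

Let bad t := 0 <= t /\ exists y, F t y < 0.

Let lorentz_not_bad t : 0 <= t -> ~ bad t -> lorentz (Mt t).
Proof.
move=> t_ge0 t_good; apply: (@lorentz_complement _ _ _ e) => //; first exact: e_Mt.
move=> y; rewrite -subr_ge0 leNgt; apply/negP => Fy; apply: t_good; split=> //.
by exists y.
Qed.

Let p y := bform N e y.

Let F_shift t s y : F (t + s) y = F t y +
  s * (2 * bform (Mt t) e y * p y - bform (Mt t) e e * bform N y y
       - p e * bform (Mt t) y y) + s ^+ 2 * (p y ^+ 2 - p e * bform N y y).
Proof.
by rewrite /F /Mt scalerDl addrA !(bformDM _ (s *: N)) !(bformZM s) -/(Mt t) /p; ring.
Qed.

(* The kernel of F t is spanned by e and the kernel of M + t N. When the latter has
   dimension 2, it is the row space of U, which is the same for all t; hence the kernel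
   of F cannot shrink and psd_perturb applies. *)
Let not_bad_right t : 0 <= t -> ~ bad t ->
  exists2 d, 0 < d & forall s, 0 <= s -> s <= d -> ~ bad (t + s).
Proof.
move=> t_ge0 t_good; have t_lor := lorentz_not_bad t_ge0 t_good.
set q := bform (Mt t) e e; have q_lt0 : q < 0 by exact: e_Mt.
pose v := e *m Mt t; pose z := e *m N.
pose A0 := v^T *m v - q *: Mt t.
pose A1 := v^T *m z + z^T *m v - q *: N - p e *: Mt t.
pose A2 := z^T *m z - p e *: N.
have A0_sym : A0^T = A0 by rewrite linearB linearZ /= (trmx_mul v^T) trmxK Mt_sym.
have A2_sym : A2^T = A2 by rewrite linearB linearZ /= (trmx_mul z^T) trmxK N_sym.
have A1_sym : A1^T = A1.
  have trE (A B C D : 'M[R]_n) a b :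
      (A + B - a *: C - b *: D)^T = A^T + B^T - a *: C^T - b *: D^T.
    by apply/matrixP => i j; rewrite !mxE.
  by rewrite trE (trmx_mul v^T) (trmx_mul z^T) !trmxK Mt_sym N_sym [X in X - _ - _]addrC.
have A0E y : bform A0 y y = F t y.
  by rewrite bformDM -scaleNr bformZM bform_outer mulNr -expr2.
have A1E y : bform A1 y y = 2 * bform (Mt t) e y * p y - q * bform N y y
       - p e * bform (Mt t) y y.
  rewrite /A1 /v /z /p; move: (Mt t) => B.
  by rewrite !bformDM !bformNM !bformZM !bform_outer /bform; ring.
have A2E y : bform A2 y y = p y ^+ 2 - p e * bform N y y.
  by rewrite bformDM -scaleNr bformZM bform_outer mulNr -expr2.
have A0_ge0 y : 0 <= bform A0 y y.
  by rewrite A0E leNgt; apply/negP => Fy; apply: t_good; split=> //; exists y.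
have kerA y : y *m A0 = 0 -> y *m A1 = 0 /\ y *m A2 = 0.
  pose c := (v *m y^T) 0 0.
  rewrite mulmxBr -scalemxAr row_outer -/c => yA0.
  have yM : q *: (y *m Mt t) = c *: v by apply/esym/eqP; rewrite -subr_eq0 yA0.
  have : (c *: e - q *: y) *m Mt t = 0.
    by rewrite mulmxBl -!scalemxAl yM subrr.
  move=> /(ker_Mt t_ge0 t_lor)/eqP; rewrite mulmxBl -!scalemxAl subr_eq0 => /eqP.
  rewrite -/z => yN.
  have yz : q * (z *m y^T) 0 0 = c * p e.
    have -> : (z *m y^T) 0 0 = bform N y e by rewrite bformC.
    by rewrite /p -[RHS]bformZl -[LHS]bformZl /bform -[in LHS]scalemxAl -yN -[in RHS]scalemxAl.
  have q_inj (x : 'rV[R]_n) : q *: x = 0 -> x = 0.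
    by move/eqP; rewrite scaler_eq0 (lt_eqF q_lt0) => /eqP.
  split; apply: q_inj.
    rewrite /A1 !mulmxBr mulmxDr -!scalemxAr !row_outer -/c -yN.
    rewrite [X in X - _ - _]addrC addrK scalerBr !scalerA yz.
    by rewrite [q * p e]mulrC -[in X in _ - X]scalerA yM scalerA [p e * c]mulrC subrr.
  rewrite /A2 mulmxBr -scalemxAr row_outer scalerBr !scalerA yz.
  by rewrite [q * p e]mulrC -[in X in _ - X]scalerA -yN scalerA mulrC subrr.
have [d d_gt0 A_ge0] := psd_perturb A0_sym A1_sym A2_sym A0_ge0 kerA.
exists d => // s s_ge0 s_le [_ [y]]; rewrite F_shift ltNge -A0E -A1E -A2E.
by rewrite A_ge0.
Qed.

(** As t grows, M + t N can acquire a second negative eigenvalue only by passing through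
    a matrix with one negative eigenvalue and corank at least 3, which kappa excludes.
    The infimum of the bad values of t is not bad, since F is continuous in t, and the
    values immediately to its right are not bad either. *)
Theorem lorentz_deform t : 0 <= t -> lorentz (M + t *: N).
Proof.
move=> t_ge0; apply: lorentz_not_bad => // t_bad.
pose S : set R := bad.
have S_inf : has_inf S.
  by split; [exists t | exists 0 => s []].
have S_lb s : S s -> inf S <= s by apply: ge_inf; case: S_inf.
have inf_ge0 : 0 <= inf S by apply: lb_le_inf; [exists t | move=> s []].
have [inf_bad|inf_good] := pselect (bad (inf S)).
  have [_ [y Fy]] := inf_bad.
  have inf_gt0 : 0 < inf S.
    rewrite lt_def inf_ge0 andbT; apply: contraTneq Fy => ->.
    by rewrite /F /Mt scale0r addr0 -leNgt subr_ge0 M_lor.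
  have [s [s_gt0 s_le Fs]] := quadratic_lt0
    (- (2 * bform (Mt (inf S)) e y * p y - bform (Mt (inf S)) e e * bform N y y
       - p e * bform (Mt (inf S)) y y)) (p y ^+ 2 - p e * bform N y y) Fy inf_gt0.
  have : inf S <= inf S - s.
    apply: S_lb; split; first by rewrite subr_ge0.
    by exists y; rewrite F_shift sqrrN mulNr -mulrN.
  by rewrite leNgt ltrBlDr ltrDl s_gt0.
have [d d_gt0 d_good] := not_bad_right inf_ge0 inf_good.
have [s s_bad s_lt] := inf_adherent d_gt0 S_inf.
have inf_s := S_lb s s_bad.
apply: (d_good (s - inf S)); rewrite ?subr_ge0 //.
  by rewrite lerBlDl ltW.
by rewrite subrKC.
Qed.

End Deformation.

(** * Nodal sets of kernel vectors *)

Definition comp_in n (G : sgraph n) (S : {set 'I_n}) (x : 'I_n) : {set 'I_n} :=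
  [set y | linked G S x y].

Lemma comp_in_linked n (G : sgraph n) (S : {set 'I_n}) x a b :
  a \in comp_in G S x -> b \in comp_in G S x ->
  linked G (comp_in G S x) a b.
Proof.
have from_x c : c \in comp_in G S x -> linked G (comp_in G S x) x c.
  rewrite inE => x_c.
  pose P c := linked G S x c /\ linked G (comp_in G S x) x c.
  suff [] : P c by [].
  apply: (linked_ind (P := P) x_c); first by split; apply: linked_refl.
  move=> k m kS mS km [x_k x_k']; have x_m : linked G S x m.
    exact: linked_trans x_k (linked1 kS mS km).
  by split=> //; apply: linked_trans x_k' (linked1 _ _ km); rewrite inE.
by move=> /from_x x_a /from_x; apply: linked_trans; rewrite linked_sym.
Qed.

Lemma comp_in_sub n (G : sgraph n) (S : {set 'I_n}) x a :
  x \in S -> a \in comp_in G S x -> a \in S.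
Proof.
by move=> xS; rewrite inE => x_a; apply: (linked_ind (P := fun c => c \in S) x_a).
Qed.

Lemma comp_in_closed n (G : sgraph n) (S : {set 'I_n}) x a b : x \in S ->
  a \in comp_in G S x -> b \in S -> G a b -> b \in comp_in G S x.
Proof.
move=> xS aC bS ab; have aS := comp_in_sub xS aC.
by move: aC; rewrite !inE => x_a; apply: linked_trans x_a (linked1 aS bS ab).
Qed.

Definition restr_vec (R : realType) n (z : 'rV[R]_n) (A : {set 'I_n}) : 'rV[R]_n :=
  \row_j (if j \in A then z 0 j else 0).

Section NodalSets.
Variables (R : realType) (n : nat) (M : 'M[R]_n) (z : 'rV[R]_n).
Hypotheses (M_sym : M^T = M) (zM : z *m M = 0).
Hypothesis M_le0 : forall i j, i != j -> M i j <= 0.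

(** A union of components of the positive support of z. *)
Definition nodal (A : {set 'I_n}) : Prop :=
  (forall i, i \in A -> 0 < z 0 i) /\
  (forall i j, i \in A -> j \notin A -> 0 < z 0 j -> M i j = 0).

Let M_C i j : M i j = M j i.
Proof. by have /matrixP/(_ j i) := M_sym; rewrite mxE. Qed.

Lemma restrict_out A j : (restr_vec z A *m M) 0 j = \sum_(k in A) z 0 k * M k j.
Proof.
rewrite mxE [RHS]big_mkcond; apply: eq_bigr => k _; rewrite mxE.
by case: ifP => // _; rewrite mul0r.
Qed.

(** The kernel equation turns the sum over A into a sum over the complement. *)
Lemma restrict_in A j :
  (restr_vec z A *m M) 0 j = - \sum_(k | k \notin A) z 0 k * M k j.
Proof.
have /rowP/(_ j) := zM; rewrite !mxE (bigID (mem A)) /=.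
by move/eqP; rewrite addr_eq0 -restrict_out mxE => /eqP.
Qed.

Lemma restrict_form A B w : bform M (restr_vec z A) (restr_vec w B) =
  \sum_(j in B) (restr_vec z A *m M) 0 j * w 0 j.
Proof.
rewrite bformE [RHS]big_mkcond; apply: eq_bigr => j _; rewrite [restr_vec w B _ _]mxE.
by case: ifP => // _; rewrite mulr0.
Qed.

Lemma nodal_out_le0 A j k : nodal A -> k \in A -> j \notin A -> z 0 k * M k j <= 0.
Proof.
move=> [A_pos _] kA jA; rewrite pmulr_rle0 ?A_pos // M_le0 //.
by apply: contraNneq jA => <-.
Qed.

Lemma nodal_in_ge0 A j k : nodal A -> j \in A -> k \notin A -> 0 <= z 0 k * M k j.
Proof.
move=> [A_pos A_closed] jA kA; case: (ltP 0 (z 0 k)) => [zk|zk].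
  by rewrite M_C A_closed // mulr0.
by rewrite mulr_le0 // M_le0 //; apply: contraNneq kA => ->.
Qed.

Lemma nodal_lt0 A j k : nodal A -> k \in A -> j \notin A -> M k j < 0 ->
  (restr_vec z A *m M) 0 j < 0.
Proof.
move=> A_nodal kA jA Mkj; rewrite restrict_out (bigD1 k) //=.
rewrite ltr_wnDr //; last by rewrite pmulr_rlt0 // (proj1 A_nodal).
rewrite sumr_le0 // => m /andP[mA _].
exact: nodal_out_le0 A_nodal mA jA.
Qed.

Lemma nodal_le0 A j : nodal A -> (restr_vec z A *m M) 0 j <= 0.
Proof.
move=> A_nodal; have [jA|jA] := boolP (j \in A).
  rewrite restrict_in oppr_le0 sumr_ge0 // => k kA.
  exact: nodal_in_ge0 A_nodal jA kA.
by rewrite restrict_out sumr_le0 // => k kA; exact: nodal_out_le0 A_nodal kA jA.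
Qed.

Lemma nodal_form_le0 A : nodal A -> bform M (restr_vec z A) (restr_vec z A) <= 0.
Proof.
move=> A_nodal; rewrite restrict_form sumr_le0 // => j jA.
by rewrite mulr_le0_ge0 ?nodal_le0 // ltW // (proj1 A_nodal).
Qed.

Lemma nodal_form_lt0 A k j : nodal A -> k \in A -> z 0 j < 0 -> M k j < 0 ->
  bform M (restr_vec z A) (restr_vec z A) < 0.
Proof.
move=> A_nodal kA zj Mkj; rewrite restrict_form (bigD1 k) //=.
have zk := proj1 A_nodal k kA.
have jA : j \notin A.
  by apply: contraTN zj => /(proj1 A_nodal); rewrite -leNgt => /ltW.
have k_lt0 : (restr_vec z A *m M) 0 k < 0.
  rewrite restrict_in oppr_lt0 (bigD1 j) //= ltr_wpDr //.
    by rewrite sumr_ge0 // => m /andP[mA _]; exact: nodal_in_ge0 A_nodal kA mA.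
  by rewrite nmulr_rgt0 // M_C.
rewrite ltr_wnDr //; last by rewrite nmulr_rlt0.
rewrite sumr_le0 // => m /andP[mA _].
by rewrite mulr_le0_ge0 ?nodal_le0 // ltW // (proj1 A_nodal).
Qed.

Lemma nodal_form_eq0 (A : {set 'I_n}) :
  (forall i j, i \in A -> j \notin A -> z 0 j != 0 -> M i j = 0) ->
  forall j, j \in A -> (restr_vec z A *m M) 0 j = 0.
Proof.
move=> A_isol j jA; rewrite restrict_in big1 ?oppr0 // => k kA.
have [->|zk] := eqVneq (z 0 k) 0; first by rewrite mul0r.
by rewrite M_C A_isol // mulr0.
Qed.

Lemma nodal_orth (A B : {set 'I_n}) w :
  (forall i j, i \in A -> j \in B -> M i j = 0) ->
  bform M (restr_vec z A) (restr_vec w B) = 0.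
Proof.
move=> AB; rewrite restrict_form big1 // => j jB.
by rewrite restrict_out big1 ?mul0r // => k kA; rewrite AB // mulr0.
Qed.

End NodalSets.

(** Suitable multiples of x and y differ by an isotropic vector orthogonal to the negative
    vector e, and such a vector lies in the kernel. *)
Lemma isotropic_parallel (R : realType) n (M : 'M[R]_n) (e x y : 'rV[R]_n) :
  M^T = M -> lorentz M -> bform M e e < 0 -> bform M x x = 0 -> bform M y y = 0 ->
  bform M x y = 0 -> x *m M != 0 -> y *m M != 0 ->
  exists2 c, c != 0 & y *m M = c *: (x *m M).
Proof.
move=> M_sym M_lor e_lt0 xx yy xy xM yM.
set a := bform M e x; set b := bform M e y.
have a_neq0 : a != 0.
  by apply: contra_neq xM => a0; apply: lorentz_isotropic e_lt0 a0 _; rewrite ?xx.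
have b_neq0 : b != 0.
  by apply: contra_neq yM => b0; apply: lorentz_isotropic e_lt0 b0 _; rewrite ?yy.
have : (a *: y - b *: x) *m M = 0.
  apply: lorentz_isotropic e_lt0 _ _ => //.
    by rewrite bformDr bformNr !bformZr -/a -/b mulrC subrr.
  rewrite !(bformDl, bformDr, bformNl, bformNr, bformZl, bformZr) (bformC y x) //.
  by rewrite xx yy xy le_eqVlt; apply/orP; left; apply/eqP; ring.
rewrite mulmxBl -!scalemxAl => /eqP; rewrite subr_eq0 => /eqP ayM.
exists (b / a); first by rewrite mulf_neq0 ?invr_eq0.
by rewrite mulrC -scalerA -ayM scalerA mulVf // scale1r.
Qed.

Section HalfSpaces.
Variables (R : realType) (n : nat) (G : sgraph n).
Hypotheses (G_2conn : two_connected G) (G_kappa : kappa R G = 2%N).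
Variable M : 'M[R]_n.
Hypotheses (M_G : G_matrix G M) (M_ws : well_signed G M) (M_lor : lorentz M).
Hypothesis M_corank : corank M = 2%N.
Implicit Types z : 'rV[R]_n.

Definition pos_part z : {set 'I_n} := [set j | 0 < z 0 j].

Let M_sym : M^T = M := proj1 M_G.

Let M_le0 i j : i != j -> M i j <= 0.
Proof. exact: offdiag_le0 M_G M_ws. Qed.

Lemma comp_in_nodal z x : 0 < z 0 x -> nodal M z (comp_in G (pos_part z) x).
Proof.
move=> zx; have xP : x \in pos_part z by rewrite inE.
split=> [i /(comp_in_sub xP)|i j iC jC zj]; first by rewrite inE.
have [ij|] := boolP (G i j).
  by rewrite (comp_in_closed xP iC _ ij) ?inE // in jC.
by apply: (proj2 M_G); apply: contraNneq jC => <-.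
Qed.

(** Otherwise A would have no neighbours at all. *)
Lemma nodal_restrict_neq0 z A x y : z *m M = 0 -> nodal M z A -> x \in A ->
  y \notin A -> restr_vec z A *m M != 0.
Proof.
move=> zM A_nodal xA; apply: contraNneq => AM.
apply: (linked_ind (P := fun k => k \in A) (linked_all G_2conn x y) xA).
move=> a b _ _ ab aA; apply: contraT => bA.
have := nodal_lt0 M_le0 A_nodal aA bA (M_ws ab).
by rewrite AM mxE ltxx.
Qed.

Let neg_vector : exists e, bform M e e < 0.
Proof. by apply: (negative_vector G_2conn M_G M_ws); rewrite M_corank. Qed.

Lemma kernel_vector_neg z : z *m M = 0 -> z != 0 -> exists i, z 0 i < 0.
Proof.
move=> zM z_neq0.
have [|||i] := @kernel_vector_pos _ _ _ G_2conn _ M_G M_ws (- z).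
- by rewrite M_corank.
- by rewrite mulNmx zM oppr0.
- by rewrite oppr_eq0.
by rewrite mxE oppr_gt0; exists i.
Qed.

Lemma restrict_adj z A w : (restr_vec z A *m M) 0 w != 0 -> w \notin A ->
  exists2 k, k \in A & G k w.
Proof.
rewrite restrict_out => /eqP s_neq0 wA; apply: contrapT => no_k; apply: s_neq0.
rewrite big1 // => k kA; have [kw|kw] := boolP (G k w).
  by case: no_k; exists k.
by rewrite (proj2 M_G) ?mulr0 //; apply: contraNneq wA => <-.
Qed.

Lemma linked_through (S D1 D2 : {set 'I_n}) x y r1 r2 w :
  r1 \in comp_in G D1 x -> r2 \in comp_in G D2 y ->
  (exists2 k, k \in comp_in G D1 x & G k w) ->
  (exists2 k, k \in comp_in G D2 y & G k w) ->
  comp_in G D1 x \subset S -> comp_in G D2 y \subset S -> w \in S ->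
  linked G S r1 r2.
Proof.
move=> r1A r2B [a aA aw] [b bB bw] AS BS wS.
have aS := fintype.subsetP AS a aA; have bS := fintype.subsetP BS b bB.
apply: linked_trans (linkedS AS (comp_in_linked r1A aA)) _.
apply: linked_trans (linked1 aS wS aw) _.
rewrite adj_sym in bw; apply: linked_trans (linked1 wS bS bw) _.
exact: linkedS BS (comp_in_linked bB r2B).
Qed.

(** The common outer neighbours number at least two, as no single node separates the
    three sets. One of them has a neighbour in each set, and any two of the three
    neighbours are linked through the second one. *)
Lemma no_three_components (D1 D2 D3 : {set 'I_n}) x1 x2 x3 :
  let A1 := comp_in G D1 x1 in let A2 := comp_in G D2 x2 in
  let A3 := comp_in G D3 x3 in
  [disjoint A1 & A2] -> [disjoint A1 & A3] -> [disjoint A2 & A3] ->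
  (forall a w, a \in A1 -> w \notin A1 -> G a w ->
     [/\ w \notin A2, w \notin A3, exists2 k, k \in A2 & G k w &
         exists2 k, k \in A3 & G k w]) -> False.
Proof.
move=> A1 A2 A3 d12 d13 d23 A1_out.
have xA D x : x \in comp_in G D x by rewrite inE linked_refl.
have exit S y : linked G S x1 y -> y \notin A1 ->
    exists a w, [/\ a \in A1, w \notin A1, w \in S & G a w].
  move=> x1_y yA; apply: contrapT => no_exit; move: yA; apply/negP; rewrite negbK.
  apply: (linked_ind (P := fun k => k \in A1) x1_y (xA _ _)) => a b _ bS ab aA1.
  by apply: contraT => bA1; case: no_exit; exists a, b.
have x2A1 : x2 \notin A1.
  by apply: contraTN (xA D2 x2) => x2A1; rewrite (disjointFr d12).
have [a1 [z1 [a1A1 z1A1 _ az1]]] := exit _ _ (linked_all G_2conn x1 x2) x2A1.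
have [z1A2 z1A3 [b1 b1A2 bz1] [c1 c1A3 cz1]] := A1_out _ _ a1A1 z1A1 az1.
have x1z1 : x1 != z1 by apply: contraNneq z1A1 => <-; exact: xA.
have x2z1 : x2 != z1 by apply: contraNneq z1A2 => <-; exact: xA.
have [a2 [z2 [a2A1 z2A1]]] := exit _ _ (linked_del1 G_2conn x1z1 x2z1) x2A1.
rewrite !inE => z21 az2.
have [z2A2 z2A3 b2 c2] := A1_out _ _ a2A1 z2A1 az2.
have a2' : exists2 k, k \in A1 & G k z2 by exists a2.
have notin (A B : {set 'I_n}) k : [disjoint A & B] -> k \in A -> k \notin B.
  by move=> AB kA; rewrite (disjointFr AB).
have neq (A : {set 'I_n}) k l : k \in A -> l \notin A -> k != l.
  by move=> kA; apply: contraNneq => <-.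
have a1A2 := notin _ _ _ d12 a1A1; have a1A3 := notin _ _ _ d13 a1A1.
have b1A3 := notin _ _ _ d23 b1A2.
rewrite disjoint_sym in d12; have b1A1 := notin _ _ _ d12 b1A2.
rewrite disjoint_sym in d13; have c1A1 := notin _ _ _ d13 c1A3.
rewrite disjoint_sym in d23; have c1A2 := notin _ _ _ d23 c1A3.
have z2in (A : {set 'I_n}) r : r \in A -> z2 \notin A -> z2 \in ~: [set z1; r].
  by move=> rA z2A; rewrite !inE negb_or z21 eq_sym (neq _ _ _ rA z2A).
apply: (@three_neighbours R _ G z1 a1 b1 c1) => //; try by rewrite adj_sym.
- exact: neq a1A1 b1A1.
- exact: neq a1A1 c1A1.
- exact: neq b1A2 c1A2.
- by apply: (linked_through a1A1 b1A2 a2' b2); rewrite ?subset_setC2 // (z2in A3).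
- by apply: (linked_through b1A2 c1A3 b2 c2); rewrite ?subset_setC2 // (z2in A1).
- by apply: (linked_through a1A1 c1A3 a2' c2); rewrite ?subset_setC2 // (z2in A2).
Qed.

(** Suppose that the positive support of z has two components. If some component P has an
    edge to the negative side, the restriction of z to P is a negative vector; the
    restriction to another component is orthogonal to it and not positive, hence in the
    kernel, which is absurd. If no edge joins the two sides, the restrictions of z to two
    positive components and a negative one are isotropic and pairwise orthogonal, so
    their images under M are parallel: the three components have the same neighbours,
    against no_three_components. *)
Theorem pos_part_connected z x y : z *m M = 0 -> 0 < z 0 x -> 0 < z 0 y ->
  linked G (pos_part z) x y.
Proof.
move=> zM zx zy; apply: contraT => x_y.
have z_neq0 : z != 0 by apply: contraTneq zx => ->; rewrite mxE ltxx.
have [m zm] := kernel_vector_neg zM z_neq0.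
pose A := comp_in G (pos_part z); have A_nodal := comp_in_nodal.
have xA k : k \in A k by rewrite inE linked_refl.
have m_out k : 0 < z 0 k -> m \notin A k.
  move=> zk; apply: contraTN zm => mA; rewrite -leNgt ltW //.
  exact: (proj1 (A_nodal _ _ zk)).
have A_sep a b k l : ~~ linked G (pos_part z) a b -> k \in A a -> l \in A b ->
    0 < z 0 a -> 0 < z 0 b -> k != l /\ ~~ G k l.
  move=> a_b ka lb za zb; split.
    apply: contraNneq a_b => kl; move: ka lb; rewrite -kl !inE => a_k.
    by rewrite linked_sym; apply: linked_trans.
  apply: contra a_b => kl; have aP : a \in pos_part z by rewrite inE.
  have bP : b \in pos_part z by rewrite inE.
  have := comp_in_closed aP ka (comp_in_sub bP lb) kl.
  rewrite inE => a_l; apply: linked_trans a_l _; rewrite linked_sym.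
  by move: lb; rewrite inE.
have M0 a b k l : ~~ linked G (pos_part z) a b -> k \in A a -> l \in A b ->
    0 < z 0 a -> 0 < z 0 b -> M k l = 0.
  by move=> a_b ka lb za zb; have [] := A_sep a b k l a_b ka lb za zb; apply: (proj2 M_G).
have [[p [q [zp zq pq]]]|no_pq] :=
    pselect (exists p q, [/\ 0 < z 0 p, z 0 q < 0 & G p q]).
  have p_lt0 := nodal_form_lt0 M_sym zM M_le0 (A_nodal _ _ zp) (xA p) zq (M_ws pq).
  have false_of k : 0 < z 0 k -> ~~ linked G (pos_part z) p k -> False.
    move=> zk p_k; have := nodal_restrict_neq0 zM (A_nodal _ _ zk) (xA k) (m_out k zk).
    apply/negP; rewrite negbK; apply/eqP.
    apply: (lorentz_isotropic M_sym M_lor p_lt0).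
      by apply: nodal_orth => i j iA jA; exact: M0 p_k iA jA zp zk.
    apply: (nodal_form_le0 M_sym zM M_le0); exact: A_nodal zk.
  have [p_x|p_x] := boolP (linked G (pos_part z) p x); last by case: (false_of x zx p_x).
  have [p_y|p_y] := boolP (linked G (pos_part z) p y); last by case: (false_of y zy p_y).
  by case/negP: x_y; rewrite linked_sym in p_x; apply: linked_trans p_y.
have {}no_pq p q : 0 < z 0 p -> z 0 q < 0 -> ~~ G p q.
  by move=> zp zq; apply/negP => pq; apply: no_pq; exists p, q.
have isol (u : 'rV[R]_n) k i j : (forall p q, 0 < u 0 p -> u 0 q < 0 -> ~~ G p q) ->
    0 < u 0 k -> i \in comp_in G (pos_part u) k ->
    j \notin comp_in G (pos_part u) k -> u 0 j != 0 -> M i j = 0.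
  move=> no_edge uk iA jA uj; have [A_pos A_closed] := comp_in_nodal uk.
  case: (ltgtP (u 0 j) 0) uj => // uj _; last exact: A_closed.
  apply: (proj2 M_G); first by apply: contraNneq jA => <-.
  by apply: no_edge => //; exact: A_pos.
have zM' : - z *m M = 0 by rewrite mulNmx zM oppr0.
have zm' : 0 < (- z) 0 m by rewrite mxE oppr_gt0.
have no_pq' p q : 0 < (- z) 0 p -> (- z) 0 q < 0 -> ~~ G p q.
  by rewrite !mxE oppr_gt0 oppr_lt0 adj_sym => zp zq; apply: no_pq.
pose C := comp_in G (pos_part (- z)) m.
have mC : m \in C by rewrite inE linked_refl.
have C_neg k : k \in C -> z 0 k < 0.
  by move=> /(proj1 (comp_in_nodal zm')); rewrite mxE oppr_gt0.
have A_pos a k : 0 < z 0 a -> k \in A a -> 0 < z 0 k.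
  by move=> za; apply: (proj1 (A_nodal _ _ za)).
have A_0 a k : 0 < z 0 a -> k \in A a -> (restr_vec z (A a) *m M) 0 k = 0.
  move=> za; apply: (nodal_form_eq0 M_sym zM) => i j.
  exact: isol no_pq za.
have C_0 k : k \in C -> (restr_vec (- z) C *m M) 0 k = 0.
  apply: (nodal_form_eq0 M_sym zM') => i j.
  exact: isol no_pq' zm'.
have A_iso a : 0 < z 0 a -> bform M (restr_vec z (A a)) (restr_vec z (A a)) = 0.
  by move=> za; rewrite restrict_form big1 // => k kA; rewrite A_0 ?mul0r.
have C_iso : bform M (restr_vec (- z) C) (restr_vec (- z) C) = 0.
  by rewrite restrict_form big1 // => k kC; rewrite C_0 ?mul0r.
have A_neq0 a : 0 < z 0 a -> restr_vec z (A a) *m M != 0.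
  move=> za; exact: nodal_restrict_neq0 zM (A_nodal _ _ za) (xA a) (m_out a za).
have xC : x \notin C by apply: contraTN zx => /C_neg; rewrite -leNgt => /ltW.
have C_neq0 : restr_vec (- z) C *m M != 0.
  exact: nodal_restrict_neq0 zM' (comp_in_nodal zm') mC xC.
have [e e_lt0] := neg_vector.
have [c c_neq0 yE] : exists2 c, c != 0 &
    restr_vec z (A y) *m M = c *: (restr_vec z (A x) *m M).
  apply: (isotropic_parallel M_sym M_lor e_lt0 (A_iso _ zx) (A_iso _ zy) _
    (A_neq0 _ zx) (A_neq0 _ zy)).
  by apply: nodal_orth => i j iA jA; apply: M0 x_y iA jA zx zy.
have [c' c'_neq0 mE] : exists2 c, c != 0 &
    restr_vec (- z) C *m M = c *: (restr_vec z (A x) *m M).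
  apply: (isotropic_parallel M_sym M_lor e_lt0 (A_iso _ zx) C_iso _
    (A_neq0 _ zx) C_neq0).
  apply: nodal_orth => i j iA jC; apply: (proj2 M_G).
    by apply: contraTneq (A_pos _ _ zx iA) => ->; rewrite -leNgt ltW ?C_neg.
  by rewrite no_pq // ?(A_pos _ _ zx iA) // C_neg.
have disj (D E : {set 'I_n}) : (forall k, k \in D -> k \in E -> False) -> [disjoint D & E].
  move=> DE; rewrite disjoint_subset; apply/fintype.subsetP => k kD; rewrite inE.
  by apply/negP => /(DE _ kD).
have AC_disj a : 0 < z 0 a -> [disjoint A a & C].
  move=> za; apply: disj => k kA kC.
  by have := lt_trans (A_pos _ _ za kA) (C_neg k kC); rewrite ltxx.
suff : False by [].
apply: (@no_three_components (pos_part z) (pos_part z) (pos_part (- z)) x y m).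
- by apply: disj => k kA kB; have [] := A_sep x y k k x_y kA kB zx zy; rewrite eqxx.
- exact: AC_disj.
- exact: AC_disj.
move=> a w aA wA aw.
have Mw : (restr_vec z (A x) *m M) 0 w != 0.
  by rewrite lt_eqF // (nodal_lt0 M_le0 (A_nodal _ _ zx) aA wA) // M_ws.
have Mwy : (restr_vec z (A y) *m M) 0 w != 0.
  by rewrite yE [_ _ w]mxE mulf_neq0.
have Mwm : (restr_vec (- z) C *m M) 0 w != 0.
  by rewrite mE [_ _ w]mxE mulf_neq0.
have wy : w \notin A y by apply: contraNN Mwy => wy; rewrite A_0.
have wm : w \notin C by apply: contraNN Mwm => wm; rewrite C_0.
by split=> //; [apply: restrict_adj Mwy wy|apply: restrict_adj Mwm wm].
Qed.

End HalfSpaces.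

Section KernelVectors.
Variables (R : realType) (n : nat) (G : sgraph n).
Hypotheses (G_2conn : two_connected G) (G_kappa : kappa R G = 2%N).
Variable M : 'M[R]_n.
Hypotheses (M_G : G_matrix G M) (M_ws : well_signed G M) (M_lor : lorentz M).
Hypothesis M_corank : corank M = 2%N.
Implicit Types z : 'rV[R]_n.

Let connected_pos z x y := @pos_part_connected R n G G_2conn G_kappa M M_G M_ws
  M_lor M_corank z x y.

Lemma pos_neighbour z v w : z *m M = 0 -> z 0 v = 0 -> G v w -> z 0 w != 0 ->
  exists2 p, G v p & 0 < z 0 p.
Proof.
move=> zM zv vw zw; apply: contrapT => no_p.
have z_le0 j : G v j -> z 0 j <= 0.
  by move=> vj; rewrite leNgt; apply/negP => zj; apply: no_p; exists j.
have /rowP/(_ v)/eqP := zM; rewrite !mxE psumr_eq0 => [/allP|j _].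
  move=> /(_ w (mem_index_enum _)) /=; rewrite mulf_eq0 (negPf zw) /=.
  by rewrite lt_eqF // M_ws // adj_sym.
have [->|jv] := eqVneq j v; first by rewrite zv mul0r.
have [vj|vj] := boolP (G v j); last by rewrite (proj2 M_G) ?mulr0 // adj_sym.
by rewrite mulr_le0 ?z_le0 // ltW // M_ws // adj_sym.
Qed.

Lemma neg_neighbour z v w : z *m M = 0 -> z 0 v = 0 -> G v w -> z 0 w != 0 ->
  exists2 p, G v p & z 0 p < 0.
Proof.
move=> zM zv vw zw.
have zM' : - z *m M = 0 by rewrite mulNmx zM oppr0.
have zv' : (- z) 0 v = 0 by rewrite mxE zv oppr0.
have zw' : (- z) 0 w != 0 by rewrite mxE oppr_eq0.
by have [p vp] := pos_neighbour zM' zv' vw zw'; rewrite mxE oppr_gt0; exists p.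
Qed.

(** Call a node bad if z vanishes there and at all its neighbours. From a bad node b next
    to a good zero z1 of z one reaches a second good zero z2 without passing through z1.
    Both z1 and z2 have neighbours on either side, so b and the neighbours of z1 on the
    two sides are linked through z2, against three_neighbours. *)
Lemma zero_has_neighbour z v : z *m M = 0 -> z != 0 -> z 0 v = 0 ->
  exists2 w, G v w & z 0 w != 0.
Proof.
move=> zM z_neq0 zv0; apply: contrapT => v_bad.
pose bad k := z 0 k = 0 /\ forall w, G k w -> z 0 w = 0.
have {}v_bad : bad v.
  split=> // w vw; apply/eqP; rewrite -[_ == _]negbK; apply/negP => zw.
  by apply: v_bad; exists w.
have zM' : - z *m M = 0 by rewrite mulNmx zM oppr0.
have [x zx] : exists x, 0 < z 0 x.
  by apply: (@kernel_vector_pos _ _ _ G_2conn _ M_G M_ws); rewrite ?M_corank.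
have bad_exit S u y : linked G S u y -> bad u -> 0 < z 0 y ->
    exists k l, [/\ bad k, G k l, z 0 l = 0, l \in S &
      ~ bad l /\ linked G (S :&: [set j | z 0 j == 0]) u k].
  move=> u_y u_bad zy; apply: contrapT => no_exit.
  suff [[zy0 _] _] : bad y /\ linked G (S :&: [set j | z 0 j == 0]) u y.
    by rewrite zy0 ltxx in zy.
  apply: (linked_ind (P := fun k => bad k /\ linked G (S :&: [set j | z 0 j == 0]) u k) u_y).
    by split; last exact: linked_refl.
  move=> k l kS lS kl [k_bad u_k]; have zl := proj2 k_bad l kl.
  have [l_bad|l_good] := pselect (bad l); last by case: no_exit; exists k, l.
  split=> //; apply: linked_trans u_k (linked1 _ _ kl); rewrite !inE.
    by rewrite kS (proj1 k_bad) eqxx.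
  by rewrite lS zl eqxx.
have good_nbrs l : z 0 l = 0 -> ~ bad l ->
    (exists2 p, G l p & 0 < z 0 p) /\ (exists2 p, G l p & z 0 p < 0).
  move=> zl l_good; have [w lw zw] : exists2 w, G l w & z 0 w != 0.
    apply: contrapT => no_w; apply: l_good; split=> // w lw.
    by apply/eqP; rewrite -[_ == _]negbK; apply/negP => zw; apply: no_w; exists w.
  by split; [apply: pos_neighbour zw|apply: neg_neighbour zw].
have [b [z1 [b_bad bz1 zz1 _ [z1_good _]]]] :=
  bad_exit _ _ _ (linked_all G_2conn v x) v_bad zx.
have [[r1 z1r1 zr1] [r2 z1r2 zr2]] := good_nbrs z1 zz1 z1_good.
have bz1_neq := adj_neq bz1; have r1z1_neq := adj_neq z1r1; rewrite eq_sym in r1z1_neq.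
have [k [z2 [k_bad kz2 zz2]]] :=
  bad_exit _ _ _ (linked_del1 G_2conn bz1_neq r1z1_neq) b_bad zr1.
rewrite !inE => z21 [z2_good b_k].
have [[p2 z2p2 zp2] [q2 z2q2 zq2]] := good_nbrs z2 zz2 z2_good.
pose Z : {set 'I_n} := ~: [set z1] :&: [set j | z 0 j == 0].
have b_z2 : linked G Z b z2.
  apply: linked_trans b_k (linked1 _ _ kz2); rewrite !inE ?z21 ?zz2 ?eqxx //.
  rewrite (proj1 k_bad) eqxx andbT; apply/negP => /eqP kz1.
  by apply: z1_good; rewrite -kz1.
have pos_out c : z 0 c <= 0 -> c \notin pos_part z by move=> zc; rewrite inE -leNgt.
have neg_out c : 0 <= z 0 c -> c \notin pos_part (- z).
  by move=> zc; rewrite inE mxE oppr_gt0 -leNgt.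
have neg l : z 0 l < 0 -> 0 < (- z) 0 l by rewrite mxE oppr_gt0.
have r1p2 := connected_pos zM zr1 zp2.
have q2r2 := connected_pos zM' (neg _ zq2) (neg _ zr2).
have zb := proj1 b_bad.
have z2_in c : c != z2 -> z2 \in ~: [set z1; c] by move=> cz2; rewrite !inE negb_or z21 eq_sym.
have b_neq : b != z2 by apply: contra_notN z2_good => /eqP <-.
have r1_neq : r1 != z2 by apply: contraTneq zr1 => ->; rewrite zz2 ltxx.
have r2_neq : r2 != z2 by apply: contraTneq zr2 => ->; rewrite zz2 ltxx.
have pos_sub c : z 0 c <= 0 -> pos_part z \subset ~: [set z1; c].
  by move=> zc; rewrite subset_setC2 // pos_out ?zz1.
have neg_sub c : 0 <= z 0 c -> pos_part (- z) \subset ~: [set z1; c].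
  by move=> zc; rewrite subset_setC2 // neg_out ?zz1.
have Z_sub c : z 0 c != 0 -> Z \subset ~: [set z1; c].
  by move=> zc; rewrite subset_setC2 // !inE ?eqxx // negb_and orbC zc.
have p_step c : c != z2 -> z 0 c <= 0 -> linked G (~: [set z1; c]) r1 z2.
  move=> cz2 zc; have sub_c := pos_sub c zc.
  apply: linked_trans (linkedS sub_c r1p2) (linked1 _ (z2_in c cz2) _).
    by apply: (fintype.subsetP sub_c); rewrite inE.
  by rewrite adj_sym.
have n_step c : c != z2 -> 0 <= z 0 c -> linked G (~: [set z1; c]) z2 r2.
  move=> cz2 zc; have sub_c := neg_sub c zc.
  apply: linked_trans (linkedS sub_c q2r2); apply: linked1 (z2_in c cz2) _ z2q2.
  by apply: (fintype.subsetP sub_c); rewrite inE neg.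
apply: (@three_neighbours R _ G z1 r1 r2 b) => //.
- by rewrite adj_sym.
- by apply: contraTneq zr1 => ->; rewrite -leNgt ltW.
- by apply: contraTneq zr1 => ->; rewrite zb ltxx.
- by apply: contraTneq zr2 => ->; rewrite zb ltxx.
- by apply: linked_trans (p_step _ b_neq _) (n_step _ b_neq _); rewrite zb.
- rewrite linked_sym; apply: linked_trans (linkedS (Z_sub r1 _) b_z2) (n_step _ r1_neq _).
    by rewrite gt_eqF.
  exact: ltW.
- apply: linked_trans (p_step _ r2_neq (ltW zr2)) _; rewrite linked_sym.
  by apply: linkedS b_z2; rewrite Z_sub // lt_eqF.
Qed.

(** Lowering the diagonal entry at a node i where the whole kernel vanishes keeps at
    most one negative eigenvalue, so in the limit M is positive semidefinite on the
    vectors vanishing at i; the positive part of a kernel vector is then isotropic, and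
    i would separate the two signs of that vector. *)
Lemma kernel_nonvanishing (U : 'M[R]_(2, n)) i : row_free U -> U *m M = 0 ->
  ~ (forall k, U k i = 0).
Proof.
move=> U_free UM U_i; pose N : 'M[R]_n := - delta_mx i i.
have M_sym := proj1 M_G.
have formN x y : bform N x y = - (x 0 i * y 0 i).
  by rewrite /N bformNM /bform -[delta_mx i i](mul_delta_mx (0 : 'I_1) i i) mulmxA -colE
    -mulmxA -rowE mxE big_ord1 !mxE.
have [e e_lt0] : exists e, bform M e e < 0.
  by apply: (negative_vector G_2conn M_G M_ws); rewrite M_corank.
have Mt_lor t : 0 <= t -> lorentz (M + t *: N).
  move=> t_ge0; apply: (lorentz_deform G_2conn G_kappa (U := U) (e := e)) => //.
  - by rewrite /N linearN /= trmx_delta.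
  - rewrite /N mulmxN; apply/eqP; rewrite oppr_eq0; apply/eqP/matrixP => k j.
    by rewrite -(mul_delta_mx (0 : 'I_1) i i) mulmxA -colE mxE big_ord1 !mxE U_i mul0r.
  - by move=> k j _; rewrite !mxE oppr_le0 ler0n.
  - move=> k j kj _; rewrite !mxE; case: (k =P i) => [ki|_]; last by rewrite oppr0.
    by rewrite -ki eq_sym (negPf kj) andbF oppr0.
  - by rewrite formN oppr_le0 -expr2 sqr_ge0.
have M_ge0 (y : 'rV[R]_n) : y 0 i = 0 -> 0 <= bform M y y.
  move=> yi; rewrite leNgt; apply/negP => y_lt0.
  pose x : 'rV[R]_n := delta_mx 0 i; pose b := bform M x y.
  (* For this t the product of the diagonal values at x and y exceeds b^2. *)
  pose t := `|M i i| + (b ^+ 2 / - bform M y y + 1).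
  have r_gt0 : 0 < - bform M y y by rewrite oppr_gt0.
  have t_ge0 : 0 <= t by rewrite addr_ge0 // addr_ge0 // divr_ge0 ?sqr_ge0 // ltW.
  have xx : bform M x x = M i i by rewrite bform_deltar -rowE mxE.
  have := Mt_lor t t_ge0 x y; rewrite !(bformDM _ (t *: N)) !(bformZM t) !formN yi xx.
  rewrite !mxE !eqxx /= !mulr0 !oppr0 !mulr0 !addr0 mulr1 mulrN1 -/b.
  have Mi := ler_norm (M i i); have tE : M i i - t <= - (b ^+ 2 / - bform M y y + 1).
    by rewrite /t; lra.
  move=> th; have /th : M i i - t < 0.
    apply: le_lt_trans tE _; rewrite oppr_lt0 ltr_wpDl // divr_ge0 ?sqr_ge0 //.
    exact: ltW.
  rewrite leNgt => /negP; apply.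
  rewrite -[_ * _]mulrNN -ltr_pdivrMr //.
  by rewrite ltrNr (le_lt_trans tE) // ltrN2 ltrDl.
pose z := row 0 U.
have zM : z *m M = 0 by rewrite -row_mul UM; apply/rowP => j; rewrite !mxE.
have z_neq0 : z != 0.
  apply/negP => /eqP z0; have /row_freeP[B UB] := U_free.
  have /matrixP/(_ 0 0)/eqP : row 0 U *m B = 0 by rewrite -/z z0 mul0mx.
  by rewrite -row_mul UB !mxE eqxx oner_eq0.
have zi : z 0 i = 0 by rewrite mxE U_i.
pose A := pos_part z.
have M_le0 k j : k != j -> M k j <= 0 by exact: offdiag_le0 M_G M_ws.
have A_nodal : nodal M z A.
  by split=> [k|k j]; rewrite !inE // => _ /negPf ->.
have zA_i : (restr_vec z A) 0 i = 0 by rewrite mxE inE zi ltxx.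
have A_iso : bform M (restr_vec z A) (restr_vec z A) = 0.
  by apply: le_anti; rewrite (nodal_form_le0 M_sym zM M_le0) //= M_ge0.
have A_ker j : j != i -> (restr_vec z A *m M) 0 j = 0.
  move=> ji; rewrite -bform_deltar; apply: isotropic_orth => // t; apply: M_ge0.
  by rewrite [LHS]mxE zA_i !mxE eqxx [i == j]eq_sym (negPf ji) mulr0 addr0.
have [x zx] : exists x, 0 < z 0 x.
  by apply: (@kernel_vector_pos _ _ _ G_2conn _ M_G M_ws); rewrite ?M_corank.
have [y zy] := kernel_vector_neg G_2conn M_G M_ws M_corank zM z_neq0.
have xi : x != i by apply: contraTneq zx => ->; rewrite zi ltxx.
have yi : y != i by apply: contraTneq zy => ->; rewrite zi ltxx.
suff : y \in A by rewrite inE ltNge ltW.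
apply: (linked_ind (P := fun k => k \in A) (linked_del1 G_2conn xi yi)).
  by rewrite inE.
move=> a b _; rewrite !inE -/A => bi ab aA; apply: contraT => bA.
have := nodal_lt0 M_le0 A_nodal (_ : a \in A) (_ : b \notin A) (M_ws ab).
by rewrite !inE => /(_ aA bA); rewrite A_ker // ltxx.
Qed.

End KernelVectors.

(** * Vectors in the plane *)

Section Plane.
Variable R : realFieldType.
Implicit Types a b c d : 'cV[R]_2.

Definition cross a b : R := a 0 0 * b 1 0 - a 1 0 * b 0 0.
Definition dot a b : R := a 0 0 * b 0 0 + a 1 0 * b 1 0.

Lemma crossC a b : cross a b = - cross b a.
Proof. by rewrite /cross; ring. Qed.

Lemma crossxx a : cross a a = 0.
Proof. by rewrite /cross; ring. Qed.

Lemma crossDl a b c : cross (a + b) c = cross a c + cross b c.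
Proof. by rewrite /cross !mxE; ring. Qed.

Lemma crossDr a b c : cross c (a + b) = cross c a + cross c b.
Proof. by rewrite /cross !mxE; ring. Qed.

Lemma crossZl s a b : cross (s *: a) b = s * cross a b.
Proof. by rewrite /cross !mxE; ring. Qed.

Lemma crossZr s a b : cross a (s *: b) = s * cross a b.
Proof. by rewrite /cross !mxE; ring. Qed.

Lemma plucker a b c d :
  cross a c * cross b d = cross a b * cross c d + cross a d * cross b c.
Proof. by rewrite /cross; ring. Qed.

Lemma cross_dot a b c :
  dot a a * cross b c = dot a b * cross a c - cross a b * dot a c.
Proof. by rewrite /cross /dot; ring. Qed.

Lemma cV2P a b : a 0 0 = b 0 0 -> a 1 0 = b 1 0 -> a = b.
Proof.
move=> ab0 ab1; apply/matrixP => i j; rewrite ord1.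
by have [->|->] : i = 0 \/ i = 1 by case: i => [[|[|[]]] ?] //; [left|right]; exact: val_inj.
Qed.

Lemma dot_gt0 a : a != 0 -> 0 < dot a a.
Proof.
move=> a_neq0; rewrite lt_def /dot -!expr2 addr_ge0 ?sqr_ge0 // andbT.
rewrite paddr_eq0 ?sqr_ge0 // !sqrf_eq0; apply: contra a_neq0 => /andP[/eqP a0 /eqP a1].
by apply/eqP/cV2P; rewrite mxE.
Qed.

(** The cotangent of the angle from a to b: it orders the directions of the open
    halfplane on the left of a. *)
Definition cot a b : R := dot a b / cross a b.

Lemma cross_lt_cot a b c : a != 0 -> 0 < cross a b -> 0 < cross a c ->
  (0 < cross b c) = (cot a c < cot a b).
Proof.
move=> a_neq0 ab ac; rewrite -(pmulr_rgt0 _ (dot_gt0 a_neq0)) cross_dot subr_gt0.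
by rewrite /cot ltr_pdivrMr // mulrAC ltr_pdivlMr // mulrC.
Qed.

Lemma cross_le_cot a b c : a != 0 -> 0 < cross a b -> 0 < cross a c ->
  (0 <= cross b c) = (cot a c <= cot a b).
Proof.
move=> a_neq0 ab ac; rewrite -oppr_le0 -crossC leNgt [in RHS]leNgt.
by rewrite (@cross_lt_cot a c b).
Qed.

End Plane.

Section PlaneSums.
Variable R : realFieldType.
Implicit Types a b c : 'cV[R]_2.

Lemma dotDr a b c : dot c (a + b) = dot c a + dot c b.
Proof. by rewrite /dot !mxE; ring. Qed.

Lemma dotZr s a b : dot a (s *: b) = s * dot a b.
Proof. by rewrite /dot !mxE; ring. Qed.

Lemma cross_sumr (I : finType) a (F : I -> 'cV[R]_2) :
  cross a (\sum_i F i) = \sum_i cross a (F i).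
Proof. by apply: big_morph => [b c|]; rewrite ?crossDr // /cross !mxE !mulr0 subr0. Qed.

Lemma dot_sumr (I : finType) a (F : I -> 'cV[R]_2) :
  dot a (\sum_i F i) = \sum_i dot a (F i).
Proof. by apply: big_morph => [b c|]; rewrite ?dotDr // /dot !mxE !mulr0 addr0. Qed.

Lemma cross_dot_eq0 a b : a != 0 -> cross a b = 0 -> dot a b = 0 -> b = 0.
Proof.
move=> a_neq0 ab ab'; have := dot_gt0 a_neq0.
have b0 : dot a a * b 0 0 = 0.
  have -> : dot a a * b 0 0 = a 0 0 * dot a b - a 1 0 * cross a b by rewrite /dot /cross; ring.
  by rewrite ab ab' !mulr0 subr0.
have b1 : dot a a * b 1 0 = 0.
  have -> : dot a a * b 1 0 = a 1 0 * dot a b + a 0 0 * cross a b by rewrite /dot /cross; ring.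
  by rewrite ab ab' !mulr0 addr0.
move=> aa_gt0; apply: cV2P; rewrite mxE; apply/eqP.
  by move/eqP: b0; rewrite mulf_eq0 gt_eqF.
by move/eqP: b1; rewrite mulf_eq0 gt_eqF.
Qed.

Lemma parallel_scale a b : a != 0 -> cross a b = 0 -> b = (dot a b / dot a a) *: a.
Proof.
move=> a_neq0 ab; apply/eqP; rewrite -subr_eq0; apply/eqP/(cross_dot_eq0 a_neq0).
  by rewrite -scaleNr crossDr crossZr crossxx ab mulr0 addr0.
by rewrite -scaleNr dotDr dotZr mulNr divfK ?subrr // gt_eqF // dot_gt0.
Qed.

End PlaneSums.

Section UnitVectors.
Variable R : realFieldType.
Implicit Types a b c d : 'cV[R]_2.

Lemma dotC a b : dot a b = dot b a.
Proof. by rewrite /dot; ring. Qed.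

Lemma dotDl a b c : dot (a + b) c = dot a c + dot b c.
Proof. by rewrite dotC dotDr !(dotC c). Qed.

Lemma dotZl s a b : dot (s *: a) b = s * dot a b.
Proof. by rewrite dotC dotZr dotC. Qed.

Lemma unit_dot_lt1 a b : dot a a = 1 -> dot b b = 1 -> a != b -> dot a b < 1.
Proof.
move=> aa bb ab; have := @dot_gt0 _ (a + -1 *: b).
rewrite scaleN1r subr_eq0 => /(_ ab); rewrite -scaleN1r.
by rewrite !(dotDl, dotDr, dotZl, dotZr) aa bb (dotC b a); lra.
Qed.

Lemma unit_dot_le1 a b : dot a a = 1 -> dot b b = 1 -> dot a b <= 1.
Proof.
move=> aa bb; have [->|ab] := eqVneq a b; first by rewrite bb.
exact/ltW/unit_dot_lt1.
Qed.

Lemma dot_chord a b t : dot a a = 1 -> dot b b = 1 ->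
  dot ((1 - t) *: a + t *: b) ((1 - t) *: a + t *: b) =
  1 - 2 * (t * (1 - t)) * (1 - dot a b).
Proof. by move=> aa bb; rewrite !(dotDl, dotDr, dotZl, dotZr) aa bb (dotC b a); ring. Qed.

(** On the line the squared norm is 1 - 2 t (1 - t) (1 - dot a b), which is 1 only for
    t = 0 and t = 1. *)
Lemma unit_chord a b c t : dot a a = 1 -> dot b b = 1 -> dot c c = 1 ->
  c = (1 - t) *: a + t *: b -> c = a \/ c = b.
Proof.
move=> aa bb cc; have [<- cE|ab cE] := eqVneq a b.
  by left; rewrite cE -scalerDl subrK scale1r.
have := dot_chord t aa bb; rewrite -cE cc => c_unit.
have p_lt1 := unit_dot_lt1 aa bb ab.
have /eqP : t * ((1 - t) * (1 - dot a b)) = 0 by lra.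
rewrite !mulf_eq0 [1 - dot a b == 0]subr_eq0 (gt_eqF p_lt1) orbF => /orP[/eqP t0|].
  by left; rewrite cE t0 subr0 scale1r scale0r addr0.
by rewrite subr_eq0 => /eqP t1; right; rewrite cE -t1 subrr scale0r add0r scale1r.
Qed.

(** The affine function vanishing on the line through a and b. *)
Definition side a b c : R := cross a b - cross c b - cross a c.

Lemma side_chord a b t : side a b ((1 - t) *: a + t *: b) = 0.
Proof. by rewrite /side !(crossDl, crossDr, crossZl, crossZr) !crossxx; ring. Qed.

Lemma side_affine a b c d s :
  side a b ((1 - s) *: c + s *: d) = (1 - s) * side a b c + s * side a b d.
Proof. by rewrite /side !(crossDl, crossDr, crossZl, crossZr); ring. Qed.

Lemma side_neq0 a b c : dot a a = 1 -> dot b b = 1 -> dot c c = 1 ->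
  a != b -> c != a -> c != b -> side a b c != 0.
Proof.
move=> aa bb cc ab ca cb; apply/negP => /eqP abc.
have ba : b + -1 *: a != 0 by rewrite scaleN1r subr_eq0 eq_sym.
have : cross (b + -1 *: a) (c + -1 *: a) = 0.
  rewrite -[RHS]abc /side !(crossDl, crossDr, crossZl, crossZr) crossxx.
  by rewrite (crossC b c) (crossC b a); ring.
move=> /(parallel_scale ba); set t := _ / _ => cE.
have : c = (1 - t) *: a + t *: b.
  have -> : c = (c + -1 *: a) + a by rewrite scaleN1r subrK.
  rewrite cE scalerDr scalerA mulrN1 scalerBl scale1r scaleNr.
  by rewrite addrC addrA addrAC.
by case/(unit_chord aa bb cc) => /eqP; apply/negP.
Qed.

(** The squares of cross c b + cross a c and of cross a b differ by
    2 (cross c b) (cross a c) (1 - dot a b). Hence the two terms have the same sign exactly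
    when the absolute value of their sum exceeds cross a b. *)
Lemma side_sector a b c : dot a a = 1 -> dot b b = 1 -> dot c c = 1 ->
  0 < cross a b -> (side a b c < 0) <-> (0 < cross a c /\ 0 < cross c b).
Proof.
move=> aa bb cc; rewrite /side.
set X := cross a b; set A := cross c b; set B := cross a c => X_gt0.
have gram : X ^+ 2 = 1 - dot a b ^+ 2.
  rewrite -[1]mulr1 -{1}aa -bb /X /cross /dot; ring.
have expand : X ^+ 2 = A ^+ 2 + B ^+ 2 + 2 * (A * B) * dot a b.
  have : X ^+ 2 * dot c c = A ^+ 2 * dot a a + B ^+ 2 * dot b b + 2 * (A * B) * dot a b.
    by rewrite /X /A /B /cross /dot; ring.
  by rewrite aa bb cc !mulr1.
have p_lt1 : dot a b < 1 by have := exprn_gt0 2 X_gt0; rewrite gram; nra.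
have key : (A + B) ^+ 2 - X ^+ 2 = 2 * (A * B) * (1 - dot a b) by rewrite expand; ring.
have q_gt0 : 0 < 1 - dot a b by rewrite subr_gt0.
split=> [s_lt0|[B_gt0 A_gt0]]; last first.
  have AB : 0 < A * B by rewrite mulr_gt0.
  have : 0 < (A + B) ^+ 2 - X ^+ 2 by rewrite key !mulr_gt0.
  by nra.
have sum_gt : X < A + B by lra.
have : 0 < (A + B) ^+ 2 - X ^+ 2.
  by rewrite subr_gt0 ltr_pXn2r // nnegrE ltW // (lt_trans X_gt0).
rewrite key pmulr_lgt0 // pmulr_rgt0 // => AB.
by split; nra.
Qed.

End UnitVectors.

(** * Halfplanes and neighbours *)

Section Directions.
Variables (R : realType) (n : nat) (G : sgraph n).
Hypotheses (G_2conn : two_connected G) (G_kappa : kappa R G = 2%N).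
Variable M : 'M[R]_n.
Hypotheses (M_G : G_matrix G M) (M_ws : well_signed G M) (M_lor : lorentz M).
Hypothesis M_corank : corank M = 2%N.
Variable U : 'M[R]_(2, n).
Hypotheses (U_free : row_free U) (UM : U *m M = 0).

Local Notation X i j := (cross (col i U) (col j U)).

(** The kernel vector given by the linear functional cross a. *)
Definition cross_row (a : 'cV[R]_2) : 'rV[R]_n := a 0 0 *: row 1 U - a 1 0 *: row 0 U.

Lemma cross_rowE a j : cross_row a 0 j = cross a (col j U).
Proof. by rewrite !mxE /cross !mxE. Qed.

Lemma cross_row_ker a : cross_row a *m M = 0.
Proof.
by rewrite /cross_row mulmxBl -!scalemxAl -!row_mul UM !row0 !scaler0 subr0.
Qed.

Lemma cross_row_neq0 a : a != 0 -> cross_row a != 0.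
Proof.
apply: contra_neq => a0; pose b : 'rV[R]_2 := \row_k (if k == 0 then - a 1 0 else a 0 0).
have /eqP : b *m U = 0.
  rewrite -[RHS]a0; apply/rowP => j; rewrite !mxE !big_ord_recl big_ord0 !mxE /=.
  by rewrite (_ : lift ord0 ord0 = 1) ?addr0 1?addrC ?mulNr //; exact: val_inj.
rewrite mulmx_free_eq0 // => /eqP b0; apply: cV2P; rewrite mxE.
  by have /rowP/(_ 1) := b0; rewrite !mxE.
by have /rowP/(_ 0)/eqP := b0; rewrite !mxE /= oppr_eq0 => /eqP.
Qed.

Lemma node_neq0 i : col i U != 0.
Proof.
apply/negP => /eqP Ui; have [] := kernel_nonvanishing G_2conn G_kappa M_G M_ws M_lor
  M_corank U_free UM (i := i).
by move=> k; have /matrixP/(_ k 0) := Ui; rewrite !mxE.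
Qed.

Lemma halfplane_connected a x y : 0 < cross a (col x U) -> 0 < cross a (col y U) ->
  linked G [set j | 0 < cross a (col j U)] x y.
Proof.
rewrite -!cross_rowE => ax ay.
have -> : [set j | 0 < cross a (col j U)] = pos_part (cross_row a).
  by apply/setP => j; rewrite !inE cross_rowE.
exact: (pos_part_connected G_2conn G_kappa M_G M_ws M_lor M_corank (cross_row_ker a)).
Qed.

Lemma halfplane_neighbours a v : a != 0 -> cross a (col v U) = 0 ->
  (exists2 w, G v w & 0 < cross a (col w U)) /\
  (exists2 w, G v w & cross a (col w U) < 0).
Proof.
move=> a_neq0; rewrite -cross_rowE => av; have aM := cross_row_ker a.
have [w vw aw] := zero_has_neighbour G_2conn G_kappa M_G M_ws M_lor M_corank aM
  (cross_row_neq0 a_neq0) av.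
have [p vp zp] := pos_neighbour M_G M_ws aM av vw aw.
have [q vq zq] := neg_neighbour M_G M_ws aM av vw aw.
by rewrite !cross_rowE in zp zq; split; [exists p|exists q].
Qed.

Lemma out_neighbour v : exists2 w, G v w & 0 < X v w.
Proof. exact: (proj1 (halfplane_neighbours (node_neq0 v) (crossxx _))). Qed.

Lemma in_neighbour v : exists2 w, G v w & X v w < 0.
Proof. exact: (proj2 (halfplane_neighbours (node_neq0 v) (crossxx _))). Qed.

Let neg_connected v x y : X v x < 0 -> X v y < 0 -> linked G [set j | X v j < 0] x y.
Proof.
move=> vx vy; have opp j : (X v j < 0) = (0 < cross (- col v U) (col j U)).
  by rewrite -scaleN1r crossZl mulN1r oppr_gt0.
have -> : [set j | X v j < 0] = [set j | 0 < cross (- col v U) (col j U)].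
  by apply/setP => j; rewrite !inE opp.
by apply: halfplane_connected; rewrite -opp.
Qed.

(** The part of the graph that r separates, together with v, from the side of v
    opposite to r lies angularly between v and r: its last node has a later
    neighbour, and that can only be r. *)
Lemma separated_between v r a q k : 0 < X v r -> a != v -> a != r -> X v q < 0 ->
  ~~ linked G (~: [set v; r]) a q -> linked G (~: [set v; r]) a k ->
  0 < X v k /\ 0 < X k r.
Proof.
move=> vr av ar vq a_q; pose K := comp_in G (~: [set v; r]) a.
have aS : a \in ~: [set v; r] by rewrite !inE negb_or av ar.
have v_neq0 := node_neq0 v.
have K_step i j : i \in K -> j != v -> j != r -> G i j -> j \in K.
  move=> iK jv jr ij; have jS : j \in ~: [set v; r] by rewrite !inE negb_or jv jr.
  exact: (comp_in_closed aS iK jS ij).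
have K_nneg i : i \in K -> 0 <= X v i.
  move=> iK; rewrite leNgt; apply: contra a_q => vi.
  move: iK; rewrite inE => a_i; apply: linked_trans a_i _.
  apply: linkedS (neg_connected vi vq); apply: subset_setC2; rewrite inE ?crossxx ?ltxx //.
  by rewrite -leNgt ltW.
have K_pos i : i \in K -> 0 < X v i.
  move=> iK; rewrite lt_def K_nneg // andbT; apply/negP => /eqP vi.
  have [_ [j ij vj]] := halfplane_neighbours v_neq0 vi.
  have : j \in K.
    by apply: K_step ij => //; apply: contraTneq vj => ->; rewrite -leNgt ?crossxx // ltW.
  by move=> /K_nneg; rewrite leNgt vj.
move=> a_k; have kK : k \in K by rewrite inE.
split; first exact: K_pos.
have [m mK m_max] := @exists_max _ _ (mem K) (fun i => - cot (col v U) (col i U)) k kK.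
have mr : 0 < X m r.
  have [j mj m_j] := out_neighbour m.
  have jv : j != v.
    by apply: contraTneq m_j => ->; rewrite crossC oppr_gt0 -leNgt ltW ?K_pos.
  have [jr|jr] := eqVneq j r; first by rewrite -jr.
  have jK := K_step _ _ mK jv jr mj; have := m_max j jK.
  rewrite lerN2 -(cross_le_cot v_neq0 (K_pos _ jK) (K_pos _ mK)).
  by rewrite crossC oppr_ge0 leNgt m_j.
rewrite (cross_lt_cot v_neq0 (K_pos _ kK) vr).
have := mr; rewrite (cross_lt_cot v_neq0 (K_pos _ mK) vr) => /lt_le_trans; apply.
by rewrite -lerN2 m_max.
Qed.

(** Let r3 be a neighbour of v on the other side; three_neighbours applies to r1, r2, r3.
    As r1 and r2 are linked within their halfplane, one of them cuts off the other from
    r3, and what is cut off lies nearer to v. *)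
Lemma nearer_neighbour_cut_off v r1 r2 k : G v r1 -> G v r2 -> r1 != r2 ->
  0 < X v r1 -> 0 < X v r2 -> 0 <= X r1 r2 -> linked G (~: [set v; r2]) r1 k ->
  0 < X v k /\ 0 < X k r2.
Proof.
move=> v1 v2 r12 vr1 vr2 le12; have [r3 v3 vr3] := in_neighbour v.
have v1_neq := adj_neq v1; have v2_neq := adj_neq v2; have v3_neq := adj_neq v3.
have r13 : r1 != r3 by apply: contraTneq vr1 => ->; rewrite -leNgt ltW.
have r23 : r2 != r3 by apply: contraTneq vr2 => ->; rewrite -leNgt ltW.
have l12 : linked G (~: [set v; r3]) r1 r2.
  apply: linkedS (halfplane_connected vr1 vr2); apply: subset_setC2.
    by rewrite inE crossxx ltxx.
  rewrite inE //.
  by rewrite -leNgt ltW.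
apply: (separated_between vr2 _ r12 vr3); first by rewrite eq_sym.
apply/negP => l13; apply: (three_neighbours G_2conn G_kappa v1 v2 v3 r12 r13 r23 l12 _ l13).
apply: contraT => l23.
have [||_] := @separated_between v r1 r2 r3 r2 vr1 _ _ vr3 l23 (linked_refl _ _ _).
- by rewrite eq_sym.
- by rewrite eq_sym.
by rewrite crossC oppr_gt0 ltNge le12.
Qed.

Definition first_out v r : Prop :=
  [/\ G v r, 0 < X v r & forall w, G v w -> 0 < X v w -> 0 <= X r w].

Lemma first_out_exists v : exists r, first_out v r.
Proof.
have [w vw v_w] := out_neighbour v.
have Pw : G v w && (0 < X v w) by rewrite vw.
have [r /andP[vr v_r] r_max] := @exists_max _ _ (fun j => G v j && (0 < X v j))
  (fun j => cot (col v U) (col j U)) w Pw.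
exists r; split=> // j vj v_j; rewrite (cross_le_cot (node_neq0 v)) //.
by rewrite r_max // vj.
Qed.

(** The edge k l joins the two sides of the line through i and j, and j has neighbours
    on both sides, so that j and two neighbours of i on the two sides are pairwise linked
    without i and the third one. *)
Lemma no_two_diameters i j k l : G i j -> X i j = 0 -> G k l -> 0 < X i k ->
  X i l < 0 -> False.
Proof.
move=> ij xij kl ik il; have [r1 i1 ir1] := out_neighbour i.
have [r2 i2 ir2] := in_neighbour i.
have [[p jp ip] [q jq iq]] := halfplane_neighbours (node_neq0 i) xij.
have pos_sub r : X i r <= 0 -> [set h | 0 < X i h] \subset ~: [set i; r].
  by move=> ir; apply: subset_setC2; rewrite inE ?crossxx ?ltxx // -leNgt.
have neg_sub r : 0 <= X i r -> [set h | X i h < 0] \subset ~: [set i; r].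
  by move=> ir; apply: subset_setC2; rewrite inE ?crossxx ?ltxx // -leNgt.
have notr r h : h != i -> h != r -> h \in ~: [set i; r].
  by move=> hi hr; rewrite !inE negb_or hi hr.
have pos_in r h : X i r <= 0 -> 0 < X i h -> h \in ~: [set i; r].
  by move=> ir ih; apply: (fintype.subsetP (pos_sub r ir)); rewrite inE.
have neg_in r h : 0 <= X i r -> X i h < 0 -> h \in ~: [set i; r].
  by move=> ir ih; apply: (fintype.subsetP (neg_sub r ir)); rewrite inE.
have ji := adj_neq ij; rewrite eq_sym in ji.
have r1j : r1 != j by apply: contraTneq ir1 => ->; rewrite xij ltxx.
have r2j : r2 != j by apply: contraTneq ir2 => ->; rewrite xij ltxx.
apply: (three_neighbours G_2conn G_kappa i1 i2 ij _ r1j r2j).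
- by apply: contraTneq ir1 => ->; rewrite -leNgt ltW.
- apply: linked_trans (linkedS (pos_sub j _) (halfplane_connected ir1 ik)) _.
    by rewrite xij.
  apply: linked_trans (linked1 _ _ kl) (linkedS (neg_sub j _) (neg_connected il ir2)).
  + by rewrite pos_in ?xij.
  + by rewrite neg_in ?xij.
  by rewrite xij.
- apply: linked_trans (linkedS (neg_sub r1 (ltW ir1)) (neg_connected ir2 iq)) _.
  apply: linked1; first by rewrite neg_in ?ltW.
    by rewrite notr // eq_sym.
  by rewrite adj_sym.
- apply: linked_trans (linkedS (pos_sub r2 (ltW ir2)) (halfplane_connected ir1 ip)) _.
  apply: linked1; first by rewrite pos_in ?ltW.
    by rewrite notr // eq_sym.
  by rewrite adj_sym.
Qed.

End Directions.

(** * The rotation by first neighbours *)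

Section Mirror.
Variables (R : realType) (n : nat) (M : 'M[R]_n) (U : 'M[R]_(2, n)).
Hypotheses (U_free : row_free U) (UM : U *m M = 0).

(** Reversing the orientation of the plane turns statements on out-neighbours into
    statements on in-neighbours. *)
Definition mirror : 'M[R]_(2, n) := xrow 0 1 U.

Lemma mirror_free : row_free mirror.
Proof.
by rewrite /mirror xrowE /row_free (eqmxMfull _ (_ : row_full _)) ?row_full_unit ?unitmx_perm.
Qed.

Lemma mirror_ker : mirror *m M = 0.
Proof. by rewrite /mirror xrowE -mulmxA UM mulmx0. Qed.

Lemma mirror_cross i j :
  cross (col i mirror) (col j mirror) = - cross (col i U) (col j U).
Proof. by rewrite /cross /mirror !mxE tpermL tpermR; ring. Qed.

End Mirror.

Section Successor.
Variables (R : realType) (n : nat) (G : sgraph n).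
Hypotheses (G_2conn : two_connected G) (G_kappa : kappa R G = 2%N).
Variable M : 'M[R]_n.
Hypotheses (M_G : G_matrix G M) (M_ws : well_signed G M) (M_lor : lorentz M).
Hypothesis M_corank : corank M = 2%N.
Variable U : 'M[R]_(2, n).
Hypotheses (U_free : row_free U) (UM : U *m M = 0).

Local Notation X i j := (cross (col i U) (col j U)).
Local Notation D i j := (dot (col i U) (col j U)).

Let node_neq0 i : col i U != 0.
Proof. exact: (node_neq0 G_2conn G_kappa M_G M_ws M_lor M_corank U_free UM). Qed.

(** Seen from r, the nearer in-neighbour v' is cut off by the farther one v. The first node
    of the part cut off has an earlier neighbour, which can only be v; it is then an
    out-neighbour of v before r. *)
Lemma first_out_inj v v' r : first_out G U v r -> first_out G U v' r -> v = v'.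
Proof.
wlog vv' : v v' / 0 <= X v v'.
  move=> th fv fv'; case: (leP 0 (X v v')) => [/th->//|/ltW vv'].
  by apply/esym/th => //; rewrite crossC oppr_ge0.
move=> [vr v_r r_first] [v'r v'_r _]; apply/eqP; apply: contraT => v_v'.
have cut k : linked G (~: [set r; v]) v' k -> 0 < X k r /\ 0 < X v k.
  move=> v'_k; have [|||||||rk kv] := @nearer_neighbour_cut_off _ _ _ G_2conn G_kappa
    _ M_G M_ws M_lor M_corank _ (mirror_free U_free) (mirror_ker UM) r v' v k.
  - by rewrite adj_sym.
  - by rewrite adj_sym.
  - by rewrite eq_sym.
  - by rewrite mirror_cross -crossC.
  - by rewrite mirror_cross -crossC.
  - by rewrite mirror_cross -crossC.
  - by [].
  by move: rk kv; rewrite !mirror_cross -!crossC.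
pose K := comp_in G (~: [set r; v]) v'.
have v'S : v' \in ~: [set r; v].
  by rewrite !inE negb_or (adj_neq v'r) eq_sym v_v'.
have v'K : v' \in K by rewrite inE linked_refl.
have cutK k : k \in K -> 0 < X k r /\ 0 < X v k by rewrite inE => /cut.
have [m mK m_max] := @exists_max _ _ (mem K) (fun i => cot (col v U) (col i U)) v' v'K.
have [m_r v_m] := cutK m mK.
have [j mj m_j] := in_neighbour G_2conn G_kappa M_G M_ws M_lor M_corank U_free UM m.
have jr : j != r by apply: contraTneq m_j => ->; rewrite -leNgt ltW.
have jv : j != v.
  apply: contraTneq m_r => jv; rewrite -leNgt crossC oppr_le0 r_first //.
  by rewrite adj_sym -jv.
have jK : j \in K.
  by apply: (comp_in_closed v'S mK _ mj); rewrite !inE negb_or jr jv.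
have [_ v_j] := cutK j jK.
by have := m_max j jK; rewrite -cross_le_cot // leNgt m_j.
Qed.

Section Rotation.
Variable s : 'I_n -> 'I_n.
Hypothesis s_first : forall v, first_out G U v (s v).

Let s_inj : injective s.
Proof. by move=> v w vw; apply: (first_out_inj (s_first v)); rewrite vw. Qed.

Let s_adj v : G v (s v). Proof. by case: (s_first v). Qed.

Let s_pos v : 0 < X v (s v). Proof. by case: (s_first v). Qed.

(** A symmetric matrix N with kernel containing the rows of U amounts to a circulation on
    the graph, with value N i j * cross u_i u_j on the arc from i to j: the diagonal can
    be chosen exactly when these values sum to zero at every node. The present one has
    the value -1 on every arc from v to s v. *)
Definition flow_offdiag : 'M[R]_n :=
  \matrix_(i, j) - ((s i == j)%:R / X i j + (s j == i)%:R / X j i).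

Definition flow_mx : 'M[R]_n := flow_offdiag +
  diag_mx (\row_i (- (\sum_j flow_offdiag i j * D i j) / D i i)).

Lemma flow_offdiag_sym : flow_offdiag^T = flow_offdiag.
Proof. by apply/matrixP => i j; rewrite !mxE addrC. Qed.

Lemma flow_mx_sym : flow_mx^T = flow_mx.
Proof. by rewrite linearD /= tr_diag_mx flow_offdiag_sym. Qed.

Lemma flow_mx_offdiag i j : i != j -> flow_mx i j = flow_offdiag i j.
Proof. by move=> ij; rewrite mxE [diag_mx _ _ _]mxE (negPf ij) mulr0n addr0. Qed.

Lemma flow_arc_ge0 i j : 0 <= (s i == j)%:R / X i j.
Proof. by case: eqP => [<-|_]; rewrite ?mul0r // mul1r invr_ge0 ltW. Qed.

Lemma flow_mx_le0 i j : i != j -> flow_mx i j <= 0.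
Proof.
by move=> ij; rewrite flow_mx_offdiag // mxE oppr_le0 addr_ge0 ?flow_arc_ge0.
Qed.

Lemma flow_mx_eq0 i j : i != j -> s i != j -> s j != i -> flow_mx i j = 0.
Proof.
by move=> ij /negPf sij /negPf sji; rewrite flow_mx_offdiag // mxE sij sji !mul0r addr0 oppr0.
Qed.

Lemma flow_mx_lt0 i : flow_mx i (s i) < 0.
Proof.
rewrite flow_mx_offdiag ?(adj_neq (s_adj i)) // mxE oppr_lt0 ltr_pwDl ?flow_arc_ge0 //.
by rewrite eqxx mul1r invr_gt0.
Qed.

(** One arc of the permutation s enters i and one leaves. *)
Lemma flow_balance i : \sum_j flow_offdiag i j * X i j = 0.
Proof.
have -> : \sum_j flow_offdiag i j * X i j =
    \sum_j ((s j == i)%:R - (s i == j)%:R).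
  apply: eq_bigr => j _; rewrite mxE.
  have [sij|_] := eqVneq (s i) j.
    have [sji|_] := eqVneq (s j) i.
      exfalso; move: (s_pos i) (s_pos j); rewrite sij sji [X j i]crossC; lra.
    by rewrite mul0r addr0 mulNr mul1r mulVf ?sub0r // gt_eqF // -sij.
  have [sji|_] := eqVneq (s j) i; last by rewrite !mul0r addr0 oppr0 mul0r ?addr0.
  by rewrite mul0r add0r mul1r [X i j]crossC mulrNN mulVf ?subr0 // gt_eqF // -sji.
rewrite sumrB (bigD1 (invF s_inj i)) //= f_invF eqxx big1 => [|j]; last first.
  by apply: contraNeq; rewrite pnatr_eq0 eqb0 negbK => /eqP <-; rewrite invF_f.
rewrite (bigD1 (s i)) //= eqxx big1 => [|j]; first by rewrite addr0 subrr.
by rewrite eq_sym => /negPf ->.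
Qed.

Lemma flow_mx_ker : U *m flow_mx = 0.
Proof.
apply/matrixP => k i.
pose w := \sum_j flow_offdiag i j *: col j U.
pose d := - (\sum_j flow_offdiag i j * D i j) / D i i.
have : w + d *: col i U = 0.
  apply: (cross_dot_eq0 (node_neq0 i)).
    rewrite crossDr crossZr crossxx mulr0 addr0 /w cross_sumr -[RHS](flow_balance i).
    by apply: eq_bigr => j _; rewrite crossZr.
  rewrite dotDr dotZr /d divfK ?gt_eqF ?dot_gt0 //; apply/eqP.
  rewrite subr_eq0 /w dot_sumr; apply/eqP/eq_bigr => j _; exact: dotZr.
move=> /matrixP/(_ k 0) wd.
have {}wd : (\sum_j flow_offdiag i j * U k j) + d * U k i = 0.
  have entryD (x y : 'cV[R]_2) : (x + d *: y) k 0 = x k 0 + d * y k 0 by rewrite !mxE.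
  move: wd; rewrite entryD [RHS]mxE [col i U _ _]mxE /w summxE => wd.
  by rewrite -[RHS]wd; congr (_ + _); apply: eq_bigr => j _; rewrite !mxE.
have flowE j : flow_mx j i = flow_offdiag i j + (if j == i then d else 0).
  rewrite /flow_mx mxE -{1}flow_offdiag_sym [_^T _ _]mxE; congr (_ + _).
  by rewrite [LHS]mxE [(\row_ _ _) _ _]mxE; case: eqP => [->|].
rewrite [LHS]mxE [RHS]mxE -[RHS]wd.
under eq_bigr => j _ do rewrite flowE mulrDr.
rewrite big_split /=; congr (_ + _).
  by apply: eq_bigr => j _; rewrite mulrC.
rewrite (bigD1 i) //= eqxx big1 ?addr0 => [|j /negPf ->]; last by rewrite mulr0.
exact: mulrC.
Qed.

(** Two places where the rotation leaves a halfplane cut the nodes of the halfplane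
    into two parts not joined by the flow matrix, hence into two orthogonal negative
    vectors; M + t flow_mx would then have two negative eigenvalues for large t. *)
Lemma single_exit a v w : 0 < cross a (col v U) -> cross a (col (s v) U) < 0 ->
  0 < cross a (col w U) -> cross a (col (s w) U) < 0 -> v = w.
Proof.
set z := cross_row U a; have zE j : cross a (col j U) = z 0 j by rewrite cross_rowE.
rewrite !zE => zv zsv zw zsw; apply/eqP; apply: contraT => v_w.
have zM : z *m M = 0 by exact: cross_row_ker.
have zN : z *m flow_mx = 0 by exact: (cross_row_ker flow_mx_ker).
have M_sym := proj1 M_G; have N_sym := flow_mx_sym.
have M_le0 i j : i != j -> M i j <= 0 by exact: offdiag_le0 M_G M_ws.
have N_le0 := flow_mx_le0.
have pos_nodal (B : 'M[R]_n) : nodal B z (pos_part z).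
  by split=> [k|k j]; rewrite !inE // => _ /negPf ->.
have vP : v \in pos_part z by rewrite inE.
pose e := restr_vec z (pos_part z).
have e_M : bform M e e < 0.
  exact: (nodal_form_lt0 M_sym zM M_le0 (pos_nodal M) vP zsv (M_ws (s_adj v))).
have e_N : bform flow_mx e e <= 0.
  exact: (nodal_form_le0 N_sym zN N_le0 (pos_nodal _)).
have N_nadj i j : i != j -> ~~ G i j -> flow_mx i j = 0.
  move=> ij ij_nadj; apply: flow_mx_eq0 => //; apply: contraNneq ij_nadj => <- //.
  by rewrite adj_sym.
have Mt_lor t : 0 <= t -> lorentz (M + t *: flow_mx).
  by apply: (lorentz_deform G_2conn G_kappa (U := U) (e := e)) => //; exact: flow_mx_ker.
(* A consists of the nodes of the halfplane from which s reaches the exit v before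
   leaving the halfplane. *)
pose to_v := connect [rel i j | [&& 0 < z 0 i, 0 < z 0 j & s i == j]].
pose A : {set 'I_n} := [set i | to_v i v].
have A_pos i : i \in A -> 0 < z 0 i.
  rewrite inE => /connectP[[|j p] /= p_path v_last]; first by rewrite -v_last.
  by case/andP: p_path => /and3P[].
have A_prev i j : 0 < z 0 i -> s i = j -> j \in A -> i \in A.
  move=> zi sij jA; have zj := A_pos j jA; rewrite !inE in jA *.
  by apply: connect_trans (connect1 _) jA; rewrite /= zi zj sij eqxx.
have A_next i : i \in A -> i != v -> s i \in A.
  rewrite inE => /connectP[[|j p] /= p_path v_last]; first by rewrite v_last eqxx.
  case/andP: p_path => /and3P[_ _ /eqP sij] p_path _.
  by rewrite inE sij; apply/connectP; exists p.
have A_closed i j : i \in A -> j \notin A -> 0 < z 0 j -> flow_mx i j = 0.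
  move=> iA jA zj; apply: flow_mx_eq0; first by apply: contraNneq jA => <-.
    apply: contraNneq jA => sij; have [iv|/(A_next i iA)] := eqVneq i v.
      by move: zsv; rewrite -iv sij ltNge ltW.
    by rewrite sij.
  by apply: contraNneq jA => sji; exact: A_prev sji iA.
pose B : {set 'I_n} := [set i | (0 < z 0 i) && (i \notin A)].
have B_pos i : i \in B -> 0 < z 0 i by rewrite inE => /andP[].
have AB i j : i \in A -> j \in B -> flow_mx i j = 0.
  by move=> iA; rewrite inE => /andP[zj jA]; exact: A_closed.
have N_C i j : flow_mx i j = flow_mx j i.
  by have /matrixP/(_ j i) := N_sym; rewrite [LHS]mxE.
have A_nodal : nodal flow_mx z A by [].
have B_nodal : nodal flow_mx z B.
  split=> // i j iB jB zj; rewrite N_C; apply: AB iB.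
  by move: jB; rewrite inE zj /= negbK.
have vA : v \in A by rewrite inE; exact: connect0.
have wA : w \notin A.
  by apply/negP => /A_next; rewrite eq_sym v_w => /(_ isT)/A_pos; rewrite ltNge ltW.
have wB : w \in B by rewrite inE zw.
pose x := restr_vec z A; pose y := restr_vec z B.
have nx : bform flow_mx x x < 0.
  exact: (nodal_form_lt0 N_sym zN N_le0 A_nodal vA zsv (flow_mx_lt0 v)).
have ny : bform flow_mx y y < 0.
  exact: (nodal_form_lt0 N_sym zN N_le0 B_nodal wB zsw (flow_mx_lt0 w)).
have nxy : bform flow_mx x y = 0 by exact: nodal_orth.
move: nx ny nxy Mt_lor; move: (flow_mx) => N nx ny nxy Mt_lor.
pose b := bform M x y; pose c := 1 + `|b|.
have c_gt0 : 0 < c by rewrite ltr_pwDl.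
have large u : bform N u u < 0 -> exists2 t, 0 <= t &
    forall t', t <= t' -> bform (M + t' *: N) u u <= - c.
  move=> nu; have nu' : 0 < - bform N u u by rewrite oppr_gt0.
  exists ((c + `|bform M u u|) / - bform N u u).
    by rewrite divr_ge0 ?ltW // ltr_pwDl // ltW.
  move=> t'; rewrite ler_pdivrMr // bformDM bformZM mulrN => t'_large.
  by have := ler_norm (bform M u u); lra.
have [t1 t1_ge0 xt1] := large x nx; have [t2 t2_ge0 yt2] := large y ny.
pose t := t1 + t2; have t_ge0 : 0 <= t by rewrite addr_ge0.
have xt : bform (M + t *: N) x x <= - c by apply: xt1; rewrite lerDl.
have yt : bform (M + t *: N) y y <= - c by apply: yt2; rewrite lerDr.
have := Mt_lor t t_ge0 x y; rewrite (bformDM _ _ x y) (bformZM _ _ x y) nxy mulr0 addr0 -/b.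
move=> /(_ (le_lt_trans xt _)); rewrite oppr_lt0 => /(_ c_gt0).
rewrite leNgt => /negP; case.
apply: (@lt_le_trans _ _ (c ^+ 2)).
  by rewrite -(real_normK (num_real b)) ltr_pXn2r ?nnegrE ?(ltW c_gt0) // /c ltrDr.
by rewrite expr2 -[bform _ x x * _]mulrNN; apply: ler_pM; rewrite ?(ltW c_gt0) // lerNr.
Qed.

Let exit_at g v w : 0 < cross (col v U) g -> cross (col (s v) U) g < 0 ->
  0 < cross (col w U) g -> cross (col (s w) U) g < 0 -> v = w.
Proof.
have opp b : cross (- g) b = cross b g by rewrite -scaleN1r crossZl mulN1r -crossC.
by rewrite -!opp; exact: single_exit.
Qed.

(** A halfplane that ends just beyond v and w would be left by s at both. *)
Lemma directions_inj v w : X v w = 0 -> 0 < D v w -> v = w.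
Proof.
wlog sle : v w / 0 <= X (s v) (s w).
  move=> th vw v_w; case: (leP 0 (X (s v) (s w))) => [/th->//|/ltW sle].
  apply/esym/th; rewrite 1?crossC ?vw ?oppr0 // ?oppr_ge0 //.
  by move: v_w; rewrite /dot ![_ * col v U _ _]mulrC.
move=> vw v_w; set c := D v w / D v v.
have c_gt0 : 0 < c by rewrite divr_gt0 // dot_gt0.
have wE : col w U = c *: col v U by exact: parallel_scale.
have := s_pos v; have := s_pos w; rewrite wE crossZl pmulr_rgt0 // => v_sw v_sv.
apply: (@exit_at (col v U + col (s v) U)); rewrite crossDr ?crossxx ?add0r ?addr0 //.
- by rewrite crossC oppr_lt0.
- by rewrite wE !crossZl crossxx mulr0 add0r mulr_gt0.
- by rewrite ltr_wnDr ?[X (s w) v]crossC ?oppr_lt0 // crossC oppr_le0.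
Qed.

(** A halfplane that ends between w and the nearer of s v and s w would be left by s at both
    v and w. *)
Lemma no_node_between v w : 0 < X v w -> ~~ (0 < X w (s v)).
Proof.
move=> vw; apply/negP => w_sv; have v_sv := s_pos v; have w_sw := s_pos w.
suff vw_eq : v = w by rewrite vw_eq crossxx ltxx in vw.
case: (leP 0 (X (s v) (s w))) => [sle|slt].
  apply: (@exit_at (col w U + col (s v) U)); rewrite crossDr ?crossxx ?add0r ?addr0 //.
  - by rewrite addr_gt0.
  - by rewrite crossC oppr_lt0.
  - by rewrite ltr_wnDr ?[X (s w) w]crossC ?oppr_lt0 // crossC oppr_le0.
have slt' : 0 < X (s w) (s v) by rewrite crossC oppr_gt0.
have v_sw : 0 < X v (s w).
  rewrite -(pmulr_lgt0 _ w_sv) plucker.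
  by rewrite addr_gt0 // mulr_gt0.
apply: (@exit_at (col w U + col (s w) U)); rewrite crossDr ?crossxx ?add0r ?addr0 //.
- by rewrite addr_gt0.
- by rewrite ltr_wnDr ?[X (s v) w]crossC ?oppr_lt0 // ltW.
- by rewrite crossC oppr_lt0.
Qed.

(** All nodes in the sector of an edge a b are reached from a by following s: the
    predecessor of such a node under s lies in the sector or is a. Hence they belong to
    the part of the graph that a and b cut off around the neighbour s a of a. *)
Lemma chord_sector a b c d : G a b -> 0 < X a b -> 0 < X a c -> 0 < X c b -> G c d ->
  [\/ d = a, d = b | 0 < X a d /\ 0 < X d b].
Proof.
move=> ab a_b a_c c_b cd; pose S : {set 'I_n} := ~: [set a; b].
have a_neq0 := node_neq0 a.
have sab : s a != b.
  by apply: contraTneq c_b => <-; exact: no_node_between.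
have sa_b : 0 <= X (s a) b by case: (s_first a) => _ _; apply.
have cut k : linked G S (s a) k -> 0 < X a k /\ 0 < X k b.
  exact: (nearer_neighbour_cut_off G_2conn G_kappa M_G M_ws M_lor M_corank U_free UM
    (s_adj a) ab sab (s_pos a) a_b sa_b).
have inS k : 0 < X a k -> 0 < X k b -> k \in S.
  move=> ak kb; rewrite !inE negb_or; apply/andP; split.
    by apply: contraTneq ak => ->; rewrite crossxx ltxx.
  by apply: contraTneq kb => ->; rewrite crossxx ltxx.
have reached k : 0 < X a k -> 0 < X k b -> linked G S (s a) k.
  move=> ak kb; apply: contraT => k_out.
  pose P k := [&& 0 < X a k, 0 < X k b & ~~ linked G S (s a) k].
  have Pk : P k by rewrite /P ak kb.
  have [m /and3P[am mb m_out] m_max] :=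
    @exists_max _ _ P (fun k => cot (col a U) (col k U)) k Pk.
  pose p := invF s_inj m; have sp : s p = m by exact: f_invF.
  have pm : 0 < X p m by rewrite -sp.
  have Gpm : G p m by rewrite -sp.
  have [ap|pa|/esym ap] := ltgtP 0 (X a p).
  - have pb : 0 < X p b.
      have pm_cot := pm; rewrite (cross_lt_cot a_neq0 ap am) in pm_cot.
      have mb_cot := mb; rewrite (cross_lt_cot a_neq0 am a_b) in mb_cot.
      by rewrite (cross_lt_cot a_neq0 ap a_b) (lt_trans mb_cot).
    have [p_in|p_out] := boolP (linked G S (s a) p).
      by case/negP: m_out; apply: linked_trans p_in (linked1 _ _ Gpm); apply: inS.
    have := m_max p; rewrite /P ap pb p_out => /(_ isT).
    by rewrite leNgt -cross_lt_cot // pm.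
  - have := no_node_between (v := p) (w := a).
    by rewrite sp am => /(_ _)/negP; case=> //; rewrite crossC oppr_gt0.
  - have pE := parallel_scale a_neq0 ap; set t := _ / _ in pE.
    have t_gt0 : 0 < t by move: pm; rewrite pE crossZl pmulr_lgt0.
    have a_p : a = p.
      apply: directions_inj => //.
      by move: t_gt0; rewrite /t pmulr_lgt0 // invr_gt0 dot_gt0.
    by case/negP: m_out; rewrite -sp -a_p linked_refl.
have sc := reached c a_c c_b.
have [->|da] := eqVneq d a; first by constructor 1.
have [->|db] := eqVneq d b; first by constructor 2.
constructor 3; apply: cut; apply: linked_trans sc (linked1 (inS _ a_c c_b) _ cd).
by rewrite !inE negb_or da db.
Qed.

End Rotation.
End Successor.

(** * Drawings on the unit circle *)

Local Open Scope classical_set_scope.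

Section StraightLines.
Variables (R : realType) (n : nat) (G : sgraph n) (u : 'I_n -> 'cV[R]_2).
Hypothesis u_unit : forall i, dot (u i) (u i) = 1.
Hypothesis u_inj : injective u.
Hypothesis sector_closed : forall a b c d, G a b -> 0 < cross (u a) (u b) ->
  0 < cross (u a) (u c) -> 0 < cross (u c) (u b) -> G c d ->
  [\/ d = a, d = b | 0 < cross (u a) (u d) /\ 0 < cross (u d) (u b)].
Hypothesis no_diameters : forall i j k l, G i j -> cross (u i) (u j) = 0 -> G k l ->
  0 < cross (u i) (u k) -> cross (u i) (u l) < 0 -> False.

Lemma u_neq0 i : u i != 0.
Proof.
apply/eqP => ui; have := u_unit i; rewrite ui /dot !mxE mul0r addr0.
by move/eqP; rewrite eq_sym oner_eq0.
Qed.

Lemma node_on_chord i j k t : u k = (1 - t) *: u i + t *: u j -> k = i \/ k = j.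
Proof. by case/(unit_chord (u_unit i) (u_unit j) (u_unit k)) => /u_inj; [left|right]. Qed.

Let side_u_neq0 i j k : i != j -> k != i -> k != j -> side (u i) (u j) (u k) != 0.
Proof. by move=> ij ki kj; apply: side_neq0; rewrite ?u_unit ?(inj_eq u_inj). Qed.

(** If an edge crosses a chord of angle less than pi, one of its ends lies in the
    sector of the chord and the other end does not. *)
Lemma no_crossing_pos i j k l s t : G i j -> G k l -> 0 < cross (u i) (u j) ->
  k != i -> k != j -> l != i -> l != j -> 0 < s -> s < 1 ->
  (1 - s) *: u k + s *: u l = (1 - t) *: u i + t *: u j -> False.
Proof.
move=> ij kl ij_pos ki kj li lj s_gt0 s_lt1 meet.
have i_j := adj_neq ij.
have sector m : side (u i) (u j) (u m) < 0 <->
    (0 < cross (u i) (u m) /\ 0 < cross (u m) (u j)).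
  exact: side_sector (u_unit i) (u_unit j) (u_unit m) ij_pos.
have one_side a b : G a b -> b != i -> b != j -> side (u i) (u j) (u a) < 0 ->
    side (u i) (u j) (u b) < 0.
  move=> ab bi bj /sector[ia aj]; apply/sector.
  by case: (sector_closed ij ij_pos ia aj ab) => // [b_i|b_j];
    [rewrite b_i eqxx in bi|rewrite b_j eqxx in bj].
have := side_affine (u i) (u j) (u k) (u l) s; rewrite meet side_chord.
have k_neq0 := side_u_neq0 i_j ki kj; have l_neq0 := side_u_neq0 i_j li lj.
have lk : G l k by rewrite adj_sym.
case: (ltgtP (side (u i) (u j) (u k)) 0) k_neq0 => // [k_lt0|k_gt0] _.
  by have := one_side _ _ kl li lj k_lt0 => l_lt0; nra.
case: (ltgtP (side (u i) (u j) (u l)) 0) l_neq0 => // [l_lt0|l_gt0] _; last by nra.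
by have := one_side _ _ lk ki kj l_lt0; rewrite ltNge ltW.
Qed.

Lemma no_crossing_ccw i j k l s t : G i j -> G k l -> cross (u i) (u j) != 0 ->
  k != i -> k != j -> l != i -> l != j -> 0 < s -> s < 1 ->
  (1 - s) *: u k + s *: u l = (1 - t) *: u i + t *: u j -> False.
Proof.
move=> ij kl ij_neq0 ki kj li lj s_gt0 s_lt1 meet.
have ji : G j i by rewrite adj_sym.
case: (ltgtP (cross (u i) (u j)) 0) ij_neq0 => // ij_sgn _; last first.
  exact: (no_crossing_pos ij kl ij_sgn ki kj li lj s_gt0 s_lt1 meet).
have ji_sgn : 0 < cross (u j) (u i) by rewrite crossC oppr_gt0.
apply: (no_crossing_pos (s := s) (t := 1 - t) ji kl) => //.
by rewrite meet subKr addrC.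
Qed.

Let antipodal i j : i != j -> cross (u i) (u j) = 0 -> u j = - u i.
Proof.
move=> i_j ij; have := parallel_scale (u_neq0 i) ij; rewrite u_unit divr1.
set c := dot _ _ => uj; have := u_unit j.
rewrite uj dotZl dotZr u_unit mulr1 -expr2 => /eqP; rewrite sqrf_eq1.
case/orP => /eqP cE; last by rewrite cE scaleN1r.
by case/eqP: i_j; apply: u_inj; rewrite uj cE scale1r.
Qed.

Lemma no_crossing i j k l s t : G i j -> G k l ->
  k != i -> k != j -> l != i -> l != j -> 0 < s -> s < 1 -> 0 < t -> t < 1 ->
  (1 - s) *: u k + s *: u l = (1 - t) *: u i + t *: u j -> False.
Proof.
move=> ij kl ki kj li lj s_gt0 s_lt1 t_gt0 t_lt1 meet.
have [ij0|] := eqVneq (cross (u i) (u j)) 0; last first.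
  by move=> ij0; apply: (no_crossing_ccw ij kl ij0 ki kj li lj s_gt0 s_lt1 meet).
have [kl0|kl0] := eqVneq (cross (u k) (u l)) 0; last first.
  by apply: (no_crossing_ccw kl ij kl0 _ _ _ _ t_gt0 t_lt1 (esym meet)); rewrite eq_sym.
have lE := antipodal (adj_neq kl) kl0.
have il : cross (u i) (u l) = - cross (u i) (u k).
  by rewrite lE -scaleN1r crossZr mulN1r.
have lk : G l k by rewrite adj_sym.
case: (ltgtP (cross (u i) (u k)) 0) => [ik|ik|ik].
- by apply: (no_diameters ij ij0 lk) => //; rewrite il oppr_gt0.
- by apply: (no_diameters ij ij0 kl) => //; rewrite il oppr_lt0.
have ik' : i != k by rewrite eq_sym.
case/eqP: lj; apply: u_inj.
case/eqP: kj; apply: u_inj.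
by rewrite (antipodal ik' ik) (antipodal (adj_neq ij) ij0).
Qed.

Lemma chords_from_node i j l s t : j != i -> l != i -> l != j -> 0 < s ->
  (1 - s) *: u i + s *: u l = (1 - t) *: u i + t *: u j -> False.
Proof.
move=> ji li lj s_gt0 meet; have s_neq0 : s != 0 by rewrite gt_eqF.
have : u l = (1 - t / s) *: u i + (t / s) *: u j.
  apply: (scalerI s_neq0); rewrite scalerDr !scalerA.
  have -> : s * (1 - t / s) = s - t by field.
  have -> : s * (t / s) = t by field.
  have -> : s *: u l = ((1 - s) *: u i + s *: u l) - (1 - s) *: u i.
    by rewrite addrC addKr.
  by rewrite meet addrAC -scalerBl; congr (_ *: _ + _); ring.
by case/node_on_chord => /eqP; apply/negP.
Qed.

Lemma straight_line : straight_line_embedding G u.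
Proof.
split=> [|i j k ij|i j k l ij kl edges x]; first exact: u_inj.
  by case=> t [_ _ /node_on_chord].
case=> t [t_ge0 t_le1 xt] [s [s_ge0 s_le1 xs]].
have common v : v \in [set i; j]%SET -> v \in [set k; l]%SET -> x = u v ->
    exists2 w, w \in ([set i; j] :&: [set k; l])%SET & x = u w.
  by move=> vij vkl xv; exists v; rewrite // inE vij.
have from_ij v : v \in [set i; j]%SET -> x = u v ->
    exists2 w, w \in ([set i; j] :&: [set k; l])%SET & x = u w.
  move=> vij xv; apply: (common v) => //.
  by move: xs; rewrite xv => /node_on_chord[->|->]; rewrite !inE eqxx ?orbT.
have from_kl v : v \in [set k; l]%SET -> x = u v ->
    exists2 w, w \in ([set i; j] :&: [set k; l])%SET & x = u w.
  move=> vkl xv; apply: (common v) => //.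
  by move: xt; rewrite xv => /node_on_chord[->|->]; rewrite !inE eqxx ?orbT.
have [t0|t_neq0] := eqVneq t 0.
  by apply: (from_ij i); rewrite ?inE ?eqxx // xt t0 subr0 scale1r scale0r addr0.
have [t1|t_neq1] := eqVneq t 1.
  by apply: (from_ij j); rewrite ?inE ?eqxx ?orbT // xt t1 subrr scale1r scale0r add0r.
have [s0|s_neq0] := eqVneq s 0.
  by apply: (from_kl k); rewrite ?inE ?eqxx // xs s0 subr0 scale1r scale0r addr0.
have [s1|s_neq1] := eqVneq s 1.
  by apply: (from_kl l); rewrite ?inE ?eqxx ?orbT // xs s1 subrr scale1r scale0r add0r.
have t_gt0 : 0 < t by rewrite lt_def t_neq0.
have s_gt0 : 0 < s by rewrite lt_def s_neq0.
have t_lt1 : t < 1 by rewrite lt_neqAle t_neq1.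
have s_lt1 : s < 1 by rewrite lt_neqAle s_neq1.
have meet : (1 - s) *: u k + s *: u l = (1 - t) *: u i + t *: u j by rewrite -xs.
have i_j := adj_neq ij; have k_l := adj_neq kl.
have meet_s : (1 - (1 - s)) *: u l + (1 - s) *: u k = (1 - t) *: u i + t *: u j.
  by rewrite -meet subKr addrC.
have meet_t : (1 - s) *: u k + s *: u l = (1 - (1 - t)) *: u j + (1 - t) *: u i.
  by rewrite meet subKr addrC.
have meet_st : (1 - (1 - s)) *: u l + (1 - s) *: u k =
    (1 - (1 - t)) *: u j + (1 - t) *: u i by rewrite meet_s subKr addrC.
have s'_gt0 : 0 < 1 - s by rewrite subr_gt0.
exfalso; have [k_i|ki] := eqVneq k i.
  rewrite k_i in meet k_l edges *; have [l_j|lj] := eqVneq l j.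
    by rewrite l_j eqxx in edges.
  by apply: chords_from_node meet; rewrite // eq_sym.
have [k_j|kj] := eqVneq k j.
  rewrite k_j in meet_t k_l edges; have [l_i|li] := eqVneq l i.
    by rewrite l_i finset.setUC eqxx in edges.
  by apply: chords_from_node meet_t; rewrite // eq_sym.
have [l_i|li] := eqVneq l i.
  by rewrite l_i in meet_s k_l edges; apply: chords_from_node meet_s; rewrite // eq_sym.
have [l_j|lj] := eqVneq l j.
  by rewrite l_j in meet_st k_l edges; apply: chords_from_node meet_st.
exact: (no_crossing ij kl ki kj li lj s_gt0 s_lt1 t_gt0 t_lt1 meet).
Qed.

Lemma drawing_in_disc x : drawing G u x -> dot x x <= 1.
Proof.
case=> [[i ->]|[i [j [_ [t [t_ge0 t_le1 ->]]]]]]; first by rewrite u_unit.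
rewrite dot_chord // lerBlDr lerDl !mulr_ge0 // subr_ge0 // unit_dot_le1 //.
Qed.

(** The part of the ray through u i outside the unit disc lies in a single face. *)
Lemma unit_on_unbounded_face i : on_unbounded_face G u i.
Proof.
pose f (s : R) : 'cV[R]_2 := s *: u i.
have f_cont : continuous f by exact: scalel_continuous.
pose ray := f @` [set` `]1, +oo[%R].
have ray_out : ray `<=` ~` drawing G u.
  move=> _ [s /= s_gt1 <-] /drawing_in_disc; apply/negP; rewrite -ltNge.
  rewrite in_itv /= andbT in s_gt1.
  by rewrite /f dotZl dotZr u_unit mulr1 -expr2 exprn_egt1.
have ray_conn : connected ray.
  apply: connected_continuous_connected; last exact: continuous_subspaceT.
  exact/connected_intervalP/interval_is_interval.
have ray_2 : ray (f 2) by exists 2 => //=; rewrite in_itv /= ltr1n.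
pose F := connected_component (~` drawing G u) (f 2).
have ray_F : ray `<=` F by exact: connected_component_max.
have ray_in s : 1 < s -> F (f s).
  by move=> s_gt1; apply: ray_F; exists s; rewrite //= in_itv /= s_gt1.
exists F; split.
- by exists (f 2) => //; exact: ray_out.
- move=> /pinfty_ex_gt0[m m_gt0 F_le].
  have nu_gt0 : 0 < `|u i| by rewrite normr_gt0 u_neq0.
  have q_gt0 : 0 < m / `|u i| by rewrite divr_gt0.
  have s_gt1 : 1 < 1 + m / `|u i| by rewrite ltrDl.
  have := F_le _ (ray_in _ s_gt1); rewrite /= normrZ gtr0_norm ?(lt_trans ltr01) //.
  by rewrite mulrDl mul1r divfK ?gt_eqF // leNgt ltrDr nu_gt0.
move=> B; have <- : f 1 = u i by rewrite /f scale1r.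
move=> B_nbhs; have f_right : f z @[z --> (1 : R)^'+] --> f 1.
  exact: cvg_at_right_filter (f_cont 1).
have near_B : \forall z \near (1 : R)^'+, B (f z) by exact: f_right.
have near_1 : \forall z \near (1 : R)^'+, 1 < z by exact: nbhs_right_gt.
have [z [Bz z_gt1]] : exists z, B (f z) /\ 1 < z.
  have FF := at_right_proper_filter (1 : R).
  have both : (1 : R)^'+ [set z | B (f z) /\ 1 < z] by exact: filterI.
  exact: (@filter_ex _ _ FF _ both).
by exists (f z); exact: (conj (ray_in _ z_gt1) Bz).
Qed.

Lemma unit_outerplanar : outerplanar_embedding G u.
Proof. by split; [exact: straight_line | exact: unit_on_unbounded_face]. Qed.

End StraightLines.

Theorem theorem17 (R : realType) (n : nat) (G : sgraph n)
    (G_2conn : two_connected G) (G_kappa : kappa R G = 2%N)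
    (M : 'M[R]_n) (M_G : G_matrix G M) (M_ws : well_signed G M)
    (M_neg : one_negative_eigenvalue M) (M_corank : corank M = 2%N)
    (U : 'M[R]_(2, n)) (U_basis : nullspace_basis M U) :
  (forall i, nullspace_rep U i != 0) /\
  outerplanar_embedding G (normalized_nullspace_rep U).
Proof.
have [U_free U_null] := U_basis; have M_sym := proj1 M_G.
have UM : U *m M = 0.
  by rewrite -M_sym; apply/sub_kermxP; rewrite U_null submx_refl.
have M_lor : lorentz M by exact: lorentz_of_one_negative.
have U_neq0 i : col i U != 0.
  exact: (node_neq0 G_2conn G_kappa M_G M_ws M_lor M_corank U_free UM).
split=> //; set u := normalized_nullspace_rep U.
pose c i := (euclidean_norm (col i U))^-1.
have uE i : u i = c i *: col i U by [].
have norm_sqr i : euclidean_norm (col i U) ^+ 2 = dot (col i U) (col i U).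
  rewrite sqr_sqrtr ?sumr_ge0 // => [|k _]; last by rewrite sqr_ge0.
  by rewrite !big_ord_recl big_ord0 addr0 /dot !expr2 (_ : lift _ _ = 1) //; exact: val_inj.
have norm_gt0 i : 0 < euclidean_norm (col i U).
  rewrite lt_def sqrtr_ge0 andbT; apply: contraTneq (dot_gt0 (U_neq0 i)) => n0.
  by rewrite -norm_sqr n0 expr0n ltxx.
have c_gt0 i : 0 < c i by rewrite invr_gt0.
have u_unit i : dot (u i) (u i) = 1.
  by rewrite uE dotZl dotZr -norm_sqr /c; field; rewrite gt_eqF.
have crossE i j : cross (u i) (u j) = c i * (c j * cross (col i U) (col j U)).
  by rewrite !uE crossZl crossZr.
have cross_gt0 i j : (0 < cross (u i) (u j)) = (0 < cross (col i U) (col j U)).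
  by rewrite crossE !pmulr_rgt0.
have cross_lt0 i j : (cross (u i) (u j) < 0) = (cross (col i U) (col j U) < 0).
  by rewrite crossE !pmulr_rlt0.
have cross_eq0 i j : cross (u i) (u j) = 0 -> cross (col i U) (col j U) = 0.
  by move/eqP; rewrite crossE !mulf_eq0 (gt_eqF (c_gt0 i)) (gt_eqF (c_gt0 j)) => /eqP.
have [s s_first] := choice (first_out_exists G_2conn G_kappa M_G M_ws M_lor M_corank
  U_free UM).
apply: unit_outerplanar => //.
- move=> i j uij; apply: (directions_inj G_2conn G_kappa M_G M_ws M_lor M_corank
    U_free UM s_first).
    by apply: cross_eq0; rewrite uij crossxx.
  have : 0 < dot (u i) (u j) by rewrite uij u_unit.
  by rewrite !uE dotZl dotZr !pmulr_rgt0.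
- move=> a b k d; rewrite !cross_gt0.
  exact: (chord_sector G_2conn G_kappa M_G M_ws M_lor M_corank U_free UM s_first).
move=> i j k l ij /cross_eq0 ij0 kl; rewrite cross_gt0 cross_lt0.
exact: (no_two_diameters G_2conn G_kappa M_G M_ws M_lor M_corank U_free UM ij ij0 kl).
Qed.
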